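(* Let $A$ be a brick gentle algebra. A collection $\{J(w^1_{\mathcal D^1}),\ldots,J(w^k_{\mathcal D^k})\}\subseteq\mathrm{JI}(\mathrm{Bic}(A))$ is a face of the canonical join complex $\Delta^{CJ}(\mathrm{Bic}(A))$ if and only if for all distinct $i,j\in\{1,\dots,k\}$ the labels $w^i_{\mathcal D^i}$ and $w^j_{\mathcal D^j}$ satisfy: (1) the strings $w^i$ and $w^j$ are distinct; (2) neither $w^i$ nor $w^j$ is expressible as a concatenation of at least two strings in $J(w^i_{\mathcal D^i})\cup J(w^j_{\mathcal D^j})$; and (3) neither $J(w^i_{\mathcal D^i})\subseteq J(w^j_{\mathcal D^j})$ nor $J(w^j_{\mathcal D^j})\subseteq J(w^i_{\mathcal D^i})$.
   Context: Setting: $k$ a field, $A=kQ/I$, $Q$ finite connected quiver, $I$ admissible generated by paths (paths composed right to left). Gentle: (S1) each vertex has at most two incoming and two outgoing arrows; (S2) for each arrow $\alpha$ at most one $\beta$ with $\alpha\beta$ a path not in $I$ and at most one $\gamma$ with $\gamma\alpha$ a path not in $I$; (G1) $I$ generated by paths of length two; (G2) for each arrow $\alpha$ at most one $\beta$ with $\alpha\beta$ a path in $I$ and at most one $\gamma$ with $\gamma\alpha$ a path in $I$. Brick gentle: moreover every indecomposable module has endomorphism ring a division ring. Strings: words $w=\gamma_d^{\epsilon_d}\cdots\gamma_1^{\epsilon_1}$ in arrows and formal inverses ($s(\gamma^{-1})=t(\gamma)$, $t(\gamma^{-1})=s(\gamma)$), consecutive letters composable, no $\gamma\gamma^{-1}$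 or $\gamma^{-1}\gamma$, neither $w$ nor $w^{-1}$ containing a subword which is a path in $I$; plus length-zero strings; $\mathrm{Str}(A)$ is the set of strings with $w\sim w^{-1}$. A concatenation of strings $u,v$ is a string $v\gamma^{\pm1}u$ ($\gamma\in Q_1$); a concatenation of $u^1,\dots,u^\ell$ is a string $u^1\alpha_1^{\pm1}u^2\cdots\alpha_{\ell-1}^{\pm1}u^\ell$ with $\alpha_i\in Q_1$. $X$ is closed if it contains every concatenation of two of its elements; $\overline X$ is the smallest closed set containing $X$; biclosed if $X$ and its complement are closed. $\mathrm{Bic}(A)$ is the lattice of biclosed sets ordered by inclusion, $\mathrm{JI}(\mathrm{Bic}(A))$ its join-irreducible elements. For $w$ of length $d$, $w=w_1\gamma_j^{\epsilon_j}w_2$ ($1\le j\le d$) gives a break $\{w_1,w_2\}$ with splits $w_1,w_2$. Labels $\mathcal S$: pairs $w_{\mathcal D}=(w,\mathcal D)$, $\mathcal D$ a set of $d$ splits of $w$ no two in the same break, modulo $(w,\mathcal D)\sim(w^{-1},\mathcal D^{-1})$. For $u\in\mathcal D$, $S(u)=S(u,\mathcal D)$ is the set of splits $v$ of $u$ that are not splits of $w$ and cannot be concatenated with any string in $\mathcal D$; $J(w_{\mathcal D}):=\overline{\{w\}\sqcup\mathcal D\sqcup\bigcup_{u\in\mathcal D}S(u)}$ (a join-irreducible biclosed set; every join-irreducible of $\mathrm{Bic}(A)$ is of this form). Canonical join complex: in a finite lattice $L$, a join $\bigvee X$ ($X\subseteq \mathrm{JI}(L)$) is irredundant if no proper subset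 has the same join; for irredundant $\bigvee X=\bigvee Y$, $X\preceq Y$ means each $x\in X$ is below some $y\in Y$; $x=\bigvee X$ is the canonical join representation of $x$ if it is irredundant and $X\preceq Y$ for every irredundant join representation $x=\bigvee Y$ with $Y\subseteq\mathrm{JI}(L)$. For a semidistributive lattice $L$ (such as $\mathrm{Bic}(A)$), $\Delta^{CJ}(L)$ is the simplicial complex whose faces are the sets $X$ such that $\bigvee X$ is a canonical join representation of some element. *)

(* Defs.v *)
From HB Require Import structures.
From mathcomp Require Import all_boot all_order all_algebra.
From mathcomp Require Import boolp classical_sets.
From Stdlib Require List.

Set Implicit Arguments.
Unset Strict Implicit.
Unset Printing Implicit Defensive.

Local Open Scope classical_set_scope.

Section BoundQuiver.
(* A finite quiver Q = (Q0, Q1, s, t) and the set R of length-two relations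
   generating the monomial ideal I: [R a b] means that the path "b a"
   (first a, then b; composition right to left) is a generator of I. *)
Variables (Q0 Q1 : finType) (s t : Q1 -> Q0) (R : rel Q1).

Definition adjacent : rel Q0 :=
  fun x y => [exists a, ((s a == x) && (t a == y)) || ((s a == y) && (t a == x))].
Definition quiver_connected : Prop := forall x y : Q0, connect adjacent x y.

Fixpoint qpath (p : seq Q1) : bool :=
  match p with a :: ((b :: _) as p') => (t a == s b) && qpath p' | _ => true end.

Fixpoint path_in_I (p : seq Q1) : bool :=
  match p with a :: ((b :: _) as p') => R a b || path_in_I p' | _ => false end.

(* I is generated by paths of length two (condition G1 built in), these
   relations are genuine paths, and I is admissible: R_Q^N <= I <= R_Q^2. *)
Definition admissible_len2 : Prop :=
  (forall a b, R a b -> t a = s b) /\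
  exists N : nat, forall p, qpath p -> N <= size p -> path_in_I p.

Definition gentle : Prop :=
  admissible_len2 /\ quiver_connected /\
  (forall v : Q0, #|[set a | s a == v]| <= 2 /\ #|[set a | t a == v]| <= 2) /\
  (forall a : Q1, #|[set b | (t b == s a) && ~~ R b a]| <= 1 /\
                  #|[set c | (t a == s c) && ~~ R a c]| <= 1) /\
  (forall a : Q1, #|[set b | (t b == s a) && R b a]| <= 1 /\
                  #|[set c | (t a == s c) && R a c]| <= 1).

Section Reps.
Variable k : fieldType.
Local Open Scope ring_scope.

(* Row-vector convention; only the component [mapv a (s a) (t a)] of
   [mapv a] is used (the other components are irrelevant junk). *)
Record rep := Rep {
  dimv : Q0 -> nat;
  mapv : Q1 -> forall x y : Q0, 'M[k]_(dimv x, dimv y) }.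

Definition bound_rep (M : rep) : Prop :=
  forall a b, R a b -> mapv M a (s a) (t a) *m mapv M b (t a) (t b) = 0.

Definition is_endo (M : rep) (f : forall x, 'M[k]_(dimv M x)) : Prop :=
  forall a, f (s a) *m mapv M a (s a) (t a) = mapv M a (s a) (t a) *m f (t a).

Definition subrep (M : rep) (U : forall x, 'M[k]_(dimv M x)) : Prop :=
  forall a, (U (s a) *m mapv M a (s a) (t a) <= U (t a))%MS.

Definition indecomposable (M : rep) : Prop :=
  (exists x, 0 < dimv M x)%N /\
  forall U V : forall x, 'M[k]_(dimv M x), subrep U -> subrep V ->
    (forall x, (U x + V x == 1%:M)%MS /\ (U x :&: V x)%MS = 0) ->
    (forall x, U x = 0) \/ (forall x, V x = 0).

Definition end_division (M : rep) : Prop :=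
  forall f : forall x, 'M[k]_(dimv M x), is_endo f -> (exists x, f x != 0) ->
    exists g, is_endo g /\ forall x, f x *m g x = 1%:M /\ g x *m f x = 1%:M.

Definition brick_gentle : Prop :=
  gentle /\ forall M : rep, bound_rep M -> indecomposable M -> end_division M.
End Reps.

(* a letter: (arrow, true) = arrow, (arrow, false) = formal inverse *)
Definition letter := (Q1 * bool)%type.
Definition lsrc (l : letter) : Q0 := if l.2 then s l.1 else t l.1.
Definition ltgt (l : letter) : Q0 := if l.2 then t l.1 else s l.1.
Definition linv (l : letter) : letter := (l.1, ~~ l.2).

(* a raw word: start vertex and letters in traversal order (the paper's
   gamma_1 first); the start vertex records length-zero strings e_x *)
Definition rstr := (Q0 * seq letter)%type.

Fixpoint walk (x : Q0) (ls : seq letter) : bool :=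
  match ls with [::] => true | l :: ls' => (lsrc l == x) && walk (ltgt l) ls' end.
Definition endv (u : rstr) : Q0 := last u.1 (map ltgt u.2).
Definition rinv (u : rstr) : rstr := (endv u, rev (map linv u.2)).

Fixpoint no_backtrack (ls : seq letter) : bool :=
  match ls with
  | l1 :: ((l2 :: _) as ls') =>
      ~~ ((l1.1 == l2.1) && (l1.2 != l2.2)) && no_backtrack ls'
  | _ => true end.

Definition no_rel_subword (ls : seq letter) : bool :=
  [forall n : 'I_(size ls).+1, forall m : 'I_(size ls).+1,
     let p := take m (drop n ls) in
     all (fun l : letter => l.2) p ==> ~~ path_in_I (map fst p)].

Definition is_string (u : rstr) : bool :=
  [&& walk u.1 u.2, no_backtrack u.2, no_rel_subword u.2 & no_rel_subword (rinv u).2].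

(* equality in Str(A) = strings modulo w ~ w^-1 *)
Definition streq (u v : rstr) : Prop := u = v \/ u = rinv v.

(* subsets of Str(A): inversion-closed predicates on strings *)
Definition strset (X : set rstr) : Prop :=
  (forall u, X u -> is_string u) /\ (forall u, X u -> X (rinv u)).

Fixpoint glue (u : rstr) (rest : seq (letter * rstr)) : rstr :=
  match rest with
  | [::] => u
  | (l, v) :: r => glue (u.1, u.2 ++ l :: v.2) r end.
Fixpoint junctions_ok (u : rstr) (rest : seq (letter * rstr)) : bool :=
  match rest with
  | [::] => true
  | (l, v) :: r => [&& lsrc l == endv u, ltgt l == v.1 &
                       junctions_ok (u.1, u.2 ++ l :: v.2) r] end.

Definition concat2 (u v z : rstr) : Prop :=
  exists u' v' (l : letter), streq u' u /\ streq v' v /\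
    junctions_ok u' [:: (l, v')] /\ is_string (glue u' [:: (l, v')]) /\
    streq z (glue u' [:: (l, v')]).

Definition concat_of (X : set rstr) (z : rstr) : Prop :=
  exists (u : rstr) (rest : seq (letter * rstr)),
    rest <> [::] /\ (exists u', X u' /\ streq u u') /\
    (forall p, List.In p rest -> exists v', X v' /\ streq p.2 v') /\
    junctions_ok u rest /\ is_string (glue u rest) /\ streq z (glue u rest).

Definition closed (X : set rstr) : Prop :=
  forall u v z, X u -> X v -> concat2 u v z -> X z.

Definition closure (X : set rstr) : set rstr :=
  fun z => is_string z /\
    forall C, strset C -> closed C -> X `<=` C -> C z.

Definition biclosed (X : set rstr) : Prop :=
  strset X /\ closed X /\ closed (fun z => is_string z /\ ~ X z).

(* break j (0 <= j < length) of w = (x, ls): w = w1 gamma w2 with gamma the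
   (j+1)-th letter in traversal order *)
Definition bleft (w : rstr) (j : nat) : rstr := (w.1, take j w.2).
Definition bright (w : rstr) (j : nat) : rstr :=
  (endv (w.1, take j.+1 w.2), drop j.+1 w.2).

Definition is_split (w u : rstr) : Prop :=
  exists j, (j < size w.2)%N /\ (streq u (bleft w j) \/ streq u (bright w j)).

Definition same_break (w u v : rstr) : Prop :=
  exists j, (j < size w.2)%N /\
    ((streq u (bleft w j) /\ streq v (bright w j)) \/
     (streq u (bright w j) /\ streq v (bleft w j))).

(* a label w_D: D is a set of d = length(w) splits of w, no two in the same
   break; D is listed as a sequence of d pairwise distinct (in Str(A)) strings *)
Definition valid_label (w : rstr) (D : seq rstr) : Prop :=
  is_string w /\ size D = size w.2 /\
  (forall u, u \in D -> is_split w u) /\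
  (forall i j, (i < size D)%N -> (j < size D)%N -> i != j ->
     ~ streq (nth w D i) (nth w D j) /\ ~ same_break w (nth w D i) (nth w D j)).

Definition Sset (w : rstr) (D : seq rstr) (u : rstr) : set rstr :=
  fun v => is_split u v /\ ~ is_split w v /\
    (forall x z, x \in D -> ~ concat2 v x z).

Definition Jgen (w : rstr) (D : seq rstr) : set rstr :=
  fun z => streq z w \/ (exists x, x \in D /\ streq z x) \/
           (exists u, u \in D /\ Sset w D u z).

Definition J (w : rstr) (D : seq rstr) : set rstr := closure (Jgen w D).

Definition finite_family (X : set (set rstr)) : Prop :=
  exists l : seq (set rstr), forall Y, X Y -> List.In Y l.

Definition is_join (X : set (set rstr)) (x : set rstr) : Prop :=
  biclosed x /\ (forall y, X y -> y `<=` x) /\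
  (forall z, biclosed z -> (forall y, X y -> y `<=` z) -> x `<=` z).

Definition JI (j : set rstr) : Prop :=
  biclosed j /\
  forall X, finite_family X -> (forall y, X y -> biclosed y) -> is_join X j -> X j.

Definition irredundant (X : set (set rstr)) (x : set rstr) : Prop :=
  is_join X x /\ forall Y, Y `<=` X -> Y <> X -> ~ is_join Y x.

Definition canonical_join_rep (x : set rstr) (X : set (set rstr)) : Prop :=
  finite_family X /\ (forall y, X y -> JI y) /\ irredundant X x /\
  forall Y, finite_family Y -> (forall y, Y y -> JI y) -> irredundant Y x ->
    forall a, X a -> exists b, Y b /\ a `<=` b.

Definition cj_face (X : set (set rstr)) : Prop :=
  exists x, biclosed x /\ canonical_join_rep x X.

End BoundQuiver.

(* Main.v *)
(** The proof rests on one description of the joinands. Write K_i for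
    J(w^i_{D^i}) and X for the join of the K_i, that is, the set of all
    concatenations of strings in the union of the K_i. In K_i no break of w^i has
    both sides, so exactly the splits in D^i lie in K_i, and K_i minus w^i is again
    biclosed. The definition of S(u) then makes K_i the least biclosed set
    containing w^i among those Z for which no break of w^i has both sides in
    Z union K_i.

    If the pairwise conditions hold, X minus w^i is biclosed: a decomposition of
    w^i in X can be shortened to one with pieces in some K_i union K_p. Hence any
    join representation of X has a joinand containing w^i, and therefore K_i.
    Conversely, if the K_i are the canonical joinands of X, then the join of the
    K_p, p <> i, and of K_i minus w^i does not contain w^i; this excludes the
    forbidden coincidences and concatenations.

    Brick gentleness enters through the fact that strings do not repeat vertices:
    a shortest string violating this is a closed walk, which carries an
    indecomposable representation with a nonzero nilpotent endomorphism. *)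

Require Import Defs.
From mathcomp Require Import all_boot all_order all_algebra.
From mathcomp Require Import boolp classical_sets.
From mathcomp Require Import zify.
Import GRing.Theory.
Set Implicit Arguments.
Unset Strict Implicit.
Unset Printing Implicit Defensive.
Local Open Scope classical_set_scope.

Section Strings.
Variables (Q0 Q1 : finType) (s t : Q1 -> Q0) (R : rel Q1).
Local Notation letter := (letter Q1).
Local Notation rstr := (rstr Q0 Q1).
Local Notation walk := (walk s t).
Local Notation endv := (endv s t).
Local Notation rinv := (rinv s t).
Local Notation bright := (bright s t).
Local Notation lsrc := (lsrc s t).
Local Notation ltgt := (ltgt s t).
Local Notation is_string := (is_string s t R).
Local Notation streq := (streq s t).
Local Notation strset := (strset s t R).
Local Notation biclosed := (biclosed s t R).
Local Notation concat2 := (concat2 s t R).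

Implicit Types (z u v w : rstr) (X Y : set rstr).

(** * Strings as chains of letters *)

(** All relations have length two, so being a string is a condition on consecutive letters. The last
    conjunct is the relation read along the inverse word. *)
Definition follows : rel letter := fun l m =>
  [&& lsrc m == ltgt l, ~~ ((l.1 == m.1) && (l.2 != m.2)),
      ~~ [&& l.2, m.2 & R l.1 m.1] & ~~ [&& ~~ l.2, ~~ m.2 & R m.1 l.1]].

Lemma no_backtrack_sorted (ls : seq letter) :
  no_backtrack ls = sorted (fun l m => ~~ ((l.1 == m.1) && (l.2 != m.2))) ls.
Proof.
case: ls => [|l ls] //; elim: ls l => [|m ls IH] l //; congr (_ && _); exact: IH.
Qed.

Lemma no_rel_subword_sorted (ls : seq letter) :
  no_rel_subword R ls = sorted (fun l m => ~~ [&& l.2, m.2 & R l.1 m.1]) ls.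
Proof.
case: ls => [|l0 ls'].
  apply/forallP => n; apply/forallP => m.
  by apply/implyP; rewrite drop_oversize.
set ls := l0 :: ls'.
apply/idP/idP => [H|H].
  apply/(sortedP l0) => i lt_i; apply/negP => /and3P[l1 l2 r12].
  have lt2 : 2 < (size ls).+1 by rewrite ltnS; lia.
  have lti : i < (size ls).+1 by lia.
  move/forallP/(_ (Ordinal lti))/forallP/(_ (Ordinal lt2)) : H.
  rewrite /= (drop_nth l0); last by lia.
  by rewrite (drop_nth l0) //= take0 /= l1 l2 r12.
apply/forallP => n; apply/forallP => m; apply/implyP.
have : sorted (fun l m : letter => ~~ [&& l.2, m.2 & R l.1 m.1])
  (take m (drop n ls)) by apply/take_sorted/drop_sorted.
elim: (take _ _) => [|l [|l' p] IH] //= /andP[h1 h2] /and3P[a1 a2 a3].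
rewrite a1 a2 /= in h1; rewrite negb_or h1 /=.
by apply: IH; rewrite //= a2 a3.
Qed.

Lemma walkE x (ls : seq letter) :
  walk x ls = (if ls is l :: _ then lsrc l == x else true) &&
              sorted (fun l m => lsrc m == ltgt l) ls.
Proof. by elim: ls x => [|l ls IH] x //=; rewrite IH; case: ls {IH}. Qed.

(** Reversal turns the condition on the inverse word into the last conjunct of [follows]. Strings
    thus become sorted lists, and stringhood passes to factors. *)
Lemma is_stringE z : is_string z =
  (if z.2 is l :: _ then lsrc l == z.1 else true) && sorted follows z.2.
Proof.
rewrite /is_string no_backtrack_sorted !no_rel_subword_sorted walkE -andbA.
congr (_ && _); rewrite /= rev_sorted sorted_map -!sorted_relI.
apply: eq_sorted => l m; rewrite /follows /relpre /=; congr [&& _, _, _ & ~~ _].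
by rewrite andbCA.
Qed.

(** * Inversion of strings and equality in Str(A) *)

Lemma linvK : involutive (@linv Q1).
Proof. by case=> a b; rewrite /linv /= negbK. Qed.

Lemma lsrc_inv l : lsrc (linv l) = ltgt l.
Proof. by case: l => a []. Qed.

Lemma ltgt_inv l : ltgt (linv l) = lsrc l.
Proof. by case: l => a []. Qed.

Lemma follows_inv l m : follows (linv m) (linv l) = follows l m.
Proof.
rewrite /follows lsrc_inv ltgt_inv /= !negbK (eq_sym m.1) (eq_sym (ltgt l)).
rewrite (inj_eq negb_inj) (eq_sym m.2); do 2 congr (_ && _).
by rewrite andbC; congr (~~ _ && ~~ _); rewrite andbCA.
Qed.

Lemma endv_cat x (l1 l2 : seq letter) : endv (x, l1 ++ l2) = endv (endv (x, l1), l2).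
Proof. by rewrite /Defs.endv map_cat last_cat. Qed.

Lemma is_string_rinv z : is_string z -> is_string (rinv z).
Proof.
rewrite !is_stringE /= => /andP[h1 h2]; apply/andP; split.
  case: z {h1 h2} => x ls; case/lastP: ls => [|ls l] //=.
  by rewrite map_rcons rev_rcons lsrc_inv /Defs.endv /= map_rcons last_rcons.
rewrite rev_sorted sorted_map.
by under eq_sorted do rewrite /relpre /= follows_inv.
Qed.

Lemma endv_rinv z : is_string z -> endv (rinv z) = z.1.
Proof.
rewrite is_stringE => /andP[]; case: z => x [|l ls] //= /eqP <- _.
by rewrite /Defs.endv /= rev_cons map_rcons last_rcons ltgt_inv.
Qed.

Lemma rinvK z : is_string z -> rinv (rinv z) = z.
Proof.
move=> zs; rewrite {1}/Defs.rinv endv_rinv // /= map_rev revK mapK; last exact: linvK.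
by case: z {zs}.
Qed.

Lemma size_rinv z : size (rinv z).2 = size z.2.
Proof. by rewrite size_rev size_map. Qed.

Lemma streq_refl z : streq z z. Proof. by left. Qed.

Lemma streq_string z z' : is_string z -> streq z' z -> is_string z'.
Proof. by move=> zs [] -> //; apply: is_string_rinv. Qed.

(** [rinv] is an involution only on strings, since a raw word may start at a vertex unrelated to its
    first letter; hence the stringhood hypothesis here and in [streq_trans]. *)
Lemma streq_sym z z' : is_string z -> streq z' z -> streq z z'.
Proof. by move=> zs [] ->; [left | right; rewrite rinvK]. Qed.

Lemma streq_trans z1 z2 z3 : is_string z3 -> streq z1 z2 -> streq z2 z3 -> streq z1 z3.
Proof.
by move=> zs [] -> [] ->; [left|right|right|left; rewrite rinvK].
Qed.

Lemma streq_size z z' : streq z z' -> size z.2 = size z'.2.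
Proof. by case=> ->; rewrite ?size_rinv. Qed.

(** * Breaks of strings *)

Lemma string_bleft z j : is_string z -> is_string (bleft z j).
Proof.
rewrite !is_stringE => /andP[h1 h2]; apply/andP; split; last exact: take_sorted.
by case: z h1 {h2} => x [|l ls] //; case: j.
Qed.

Lemma string_bright z j : is_string z -> is_string (bright z j).
Proof.
rewrite !is_stringE => /andP[h1 h2]; apply/andP; split; last exact: drop_sorted.
case: z h2 {h1} => x ls /= ss; case: (ltnP j.+1 (size ls)) => [lt|ge]; last first.
  by rewrite drop_oversize.
case: ls ss lt => // l0 ls ss lt.
rewrite (drop_nth l0) // (take_nth l0); last by lia.
rewrite /Defs.endv /= map_rcons last_rcons.
by move/(sortedP l0): ss => /(_ j lt) /and4P[].
Qed.

Lemma string_nth_break l0 z j : is_string z -> j < size z.2 ->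
  lsrc (nth l0 z.2 j) = endv (bleft z j) /\ ltgt (nth l0 z.2 j) = (bright z j).1.
Proof.
case: z => x ls /= zs lt; split; last first.
  by rewrite /Defs.endv (take_nth l0) //= map_rcons last_rcons.
have [j0|j1] := posnP j.
  subst j; move: zs; rewrite is_stringE => /andP[/= + _].
  by case: ls lt => // l ls _ /eqP.
case: j j1 lt => // j _ lt.
rewrite /Defs.endv /bleft /= (take_nth l0); last by lia.
rewrite /= map_rcons last_rcons.
by move: zs; rewrite is_stringE => /andP[_ /= /(sortedP l0) /(_ j lt) /and4P[/eqP]].
Qed.

Lemma glue_break z j : is_string z -> j < size z.2 -> exists l,
  junctions_ok s t (bleft z j) [:: (l, bright z j)] /\
  glue (bleft z j) [:: (l, bright z j)] = z.
Proof.
case: z => x [|l0 ls] // zs lt; exists (nth l0 (l0 :: ls) j).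
have [h1 h2] := string_nth_break l0 zs lt.
split; last by rewrite /glue /bleft /bright /= -drop_nth // cat_take_drop.
by apply/and3P; split => //; [rewrite h1 | rewrite h2].
Qed.

Lemma break_glue u v l : junctions_ok s t u [:: (l, v)] ->
  let z := glue u [:: (l, v)] in
  [/\ size u.2 < size z.2, bleft z (size u.2) = u & bright z (size u.2) = v].
Proof.
case: u v => x us [y vs] /= /and3P[/eqP h1 /eqP h2 _]; split.
- by rewrite size_cat /=; lia.
- by rewrite /bleft /= take_size_cat.
- rewrite /Defs.bright /= take_cat drop_cat ltnNge leqnSn /= subSnn /= take0 drop0.
  by rewrite endv_cat /= /Defs.endv /= -h2.
Qed.

(** Inversion swaps the two sides of a break and reverses the numbering of the breaks. *)
Lemma rinv_bleft z j : is_string z -> j < size z.2 ->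
  rinv (bleft z j) = bright (rinv z) (size z.2 - j.+1).
Proof.
move=> zs lt; have [l [jo zE]] := glue_break zs lt.
have lt' : size z.2 - j.+1 < size (rinv z).2 by rewrite size_rinv; lia.
have := glue_break (is_string_rinv zs) lt'.
case: z zs lt {jo zE l lt'} => x ls zs /= lt _.
rewrite /Defs.rinv /Defs.bright /bleft /=.
have E : rev (map (@linv Q1) (take j ls)) =
         drop (size ls - j.+1).+1 (rev (map (@linv Q1) ls)).
  rewrite drop_rev size_map map_take; congr (rev (take _ _)).
  by lia.
congr (_, _) => //.
have e := endv_rinv zs; rewrite /Defs.rinv /= in e.
rewrite subnSK // take_rev size_map subKn; last by lia.
rewrite -map_drop /Defs.endv /=.
case: ls zs lt {E e} => [|l0 ls] // zs lt.
rewrite (drop_nth l0) //= rev_cons map_rcons last_rcons ltgt_inv.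
by have [] := string_nth_break l0 zs lt; rewrite /Defs.endv /= => ->.
Qed.

Lemma rinv_bright z j : is_string z -> j < size z.2 ->
  rinv (bright z j) = bleft (rinv z) (size z.2 - j.+1).
Proof.
move=> zs lt; have zs' := is_string_rinv zs.
have lt' : size z.2 - j.+1 < size (rinv z).2 by rewrite size_rinv; lia.
have := rinv_bleft zs' lt'; rewrite rinvK // size_rinv.
have -> : size z.2 - (size z.2 - j.+1).+1 = j by lia.
by move=> <-; rewrite rinvK //; apply: string_bleft.
Qed.

Lemma bleft_bleft z i j : j <= i -> bleft (bleft z i) j = bleft z j.
Proof. by move=> le; rewrite /bleft /= take_takel. Qed.

(** The letter removed by a break belongs to neither side; this accounts for the extra one in the
    index. *)
Lemma bright_bright z i j : bright (bright z j) i = bright z (j + i.+1).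
Proof.
rewrite /Defs.bright /= drop_drop; congr (_, _); last by congr drop; lia.
have -> : (j + i.+1).+1 = j.+1 + i.+1 by lia.
by rewrite takeD endv_cat.
Qed.

Lemma bright_bleft z i j : j < i -> bright (bleft z i) j = bleft (bright z j) (i - j.+1).
Proof.
move=> lt; rewrite /Defs.bright /bleft /= take_takel // take_drop.
by rewrite subnK.
Qed.

Lemma size_bleft z j : j < size z.2 -> size (bleft z j).2 = j.
Proof. by move=> lt; rewrite /= size_takel // ltnW. Qed.

Lemma size_bright z j : size (bright z j).2 = size z.2 - j.+1.
Proof. by rewrite /= size_drop. Qed.

(** * Closed and biclosed sets in terms of breaks *)

Lemma strset_streq X u v : strset X -> is_string u -> streq u v -> X v -> X u.
Proof. by move=> [_ Xi] _ [] -> // /Xi. Qed.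

Lemma concat2_break z j : is_string z -> j < size z.2 ->
  concat2 (bleft z j) (bright z j) z.
Proof.
move=> zs lt; have [l [jo E]] := glue_break zs lt.
exists (bleft z j), (bright z j), l; rewrite E.
by do 2 (split; first exact: streq_refl); do 2 split => //; left.
Qed.

(** An inversion-closed set does not distinguish a string from its inverse, so every concatenation
    of two elements can be read as a break of a string. *)
Lemma closedP X : strset X ->
  Defs.closed s t R X <-> (forall z j, is_string z -> j < size z.2 ->
                 X (bleft z j) -> X (bright z j) -> X z).
Proof.
move=> sX; split=> [cX z j zs lt Xl Xr|cX u v z Xu Xv].
  exact: (cX _ _ _ Xl Xr (concat2_break zs lt)).
move=> [u' [v' [l [uu [vv [jo [zs' zz]]]]]]].
have [lt el er] := break_glue jo.
have us' : is_string u' by rewrite -el; apply: string_bleft.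
have vs' : is_string v' by rewrite -er; apply: string_bright.
apply: (strset_streq sX _ zz); first exact: streq_string zz.
apply: (cX _ (size u'.2)) => //.
  by rewrite el; apply: strset_streq uu Xu.
by rewrite er; apply: strset_streq vv Xv.
Qed.

Lemma biclosedP X : biclosed X <-> [/\ strset X,
  forall z j, is_string z -> j < size z.2 -> X (bleft z j) -> X (bright z j) -> X z &
  forall z j, j < size z.2 -> X z -> X (bleft z j) \/ X (bright z j)].
Proof.
have sC : strset X -> strset (fun z => is_string z /\ ~ X z).
  move=> [Xs Xi]; split=> [u []//|u [us Xu]]; split; first exact: is_string_rinv.
  by move=> /Xi; rewrite rinvK.
split=> [[sX [/(closedP sX) cX /(closedP (sC sX)) coX]]|[sX cX coX]].
  split=> // z j lt Xz; have zs := sX.1 _ Xz.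
  apply: contrapT => /not_orP[Xl Xr].
  have [//|//|_ //] := coX z j zs lt; split => //; first exact: string_bleft.
  exact: string_bright.
split=> //; split; first exact/closedP.
apply/closedP; first exact: sC.
by move=> z j zs lt [_ Xl] [_ Xr]; split=> // /(coX _ _ lt) [].
Qed.

(** * Concatenations and biclosed sets *)

(** Nested to the right, so that induction strips off the leftmost piece. *)
Inductive concats X : rstr -> Prop :=
| concats_base z : X z -> concats X z
| concats_step z j : is_string z -> j < size z.2 ->
    X (bleft z j) -> concats X (bright z j) -> concats X z.

Lemma concats_string X z : strset X -> concats X z -> is_string z.
Proof. by move=> sX [z' /sX.1|]. Qed.

Lemma concats_cat X z j : is_string z -> j < size z.2 ->
  concats X (bleft z j) -> concats X (bright z j) -> concats X z.
Proof.
move=> zs lt Sl; move: {-2}(bleft z j) Sl (erefl (bleft z j)) => y Sl.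
elim: Sl z j zs lt => [y' Xy|y' i ys lti Xl Sr IH] z j zs lt Ey Sz; subst y'.
  exact: (concats_step zs lt).
rewrite size_bleft // in lti; rewrite bleft_bleft in Xl; last exact: ltnW.
apply: (concats_step zs _ Xl); first exact: ltn_trans lti lt.
apply: (IH _ (j - i.+1)).
- exact: string_bright.
- by rewrite size_bright; lia.
- by rewrite bright_bleft.
- by rewrite bright_bright; have -> : i + (j - i.+1).+1 = j by lia.
Qed.

Lemma concats_strset X : strset X -> strset (concats X).
Proof.
move=> sX; split=> [z|z]; first exact: concats_string.
elim=> {z} [z Xz|z j zs lt Xl _ IH]; first by apply: concats_base; apply: sX.2.
have lt' : size z.2 - j.+1 < size (rinv z).2 by rewrite size_rinv; lia.
apply: (concats_cat (is_string_rinv zs) lt'); first by rewrite -(rinv_bright zs).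
by rewrite -(rinv_bleft zs) //; apply: concats_base; apply: sX.2.
Qed.

Lemma concats_min X Y : (forall z j, is_string z -> j < size z.2 ->
    Y (bleft z j) -> Y (bright z j) -> Y z) ->
  X `<=` Y -> concats X `<=` Y.
Proof.
move=> cY XY z; elim=> {z} [z /XY //|z j zs lt /XY Yl _ Yr].
exact: cY lt Yl Yr.
Qed.

Lemma closureE X : strset X -> Defs.closure s t R X = concats X.
Proof.
move=> sX; apply/seteqP; split=> z.
  move=> [zs /(_ (concats X))]; apply; first exact: concats_strset.
    by apply/(closedP (concats_strset sX)) => z' j; apply: concats_cat.
  exact: concats_base.
move=> Sz; split; first exact: concats_string Sz.
by move=> C sC /(closedP sC) cC XC; apply: (concats_min cC XC).
Qed.

(** A break of a concatenation falls on a junction, among the later pieces, or inside the first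
    piece. In the last two cases the side provided by induction or by [coX] is completed with the
    pieces next to it. *)
Lemma concats_biclosed X : strset X ->
  (forall z j, j < size z.2 -> X z -> concats X (bleft z j) \/ concats X (bright z j)) ->
  biclosed (concats X).
Proof.
move=> sX coX; apply/biclosedP; split; first exact: concats_strset.
  by move=> z j; apply: concats_cat.
move=> z j lt Sz; elim: Sz j lt => {z} [z Xz|z i zs lti Xl Sr IH] j lt.
  exact: coX.
case: (ltngtP i j) => [ij|ji|<-]; last by left; apply: concats_base.
  have [|Sl|Sb] := IH (j - i.+1); first by rewrite size_bright; lia.
    left; apply: (@concats_cat _ (bleft z j) i).
    + exact: string_bleft.
    + by rewrite size_bleft.
    + by rewrite bleft_bleft 1?ltnW //; apply: concats_base.
    + by rewrite bright_bleft.
  by right; move: Sb; rewrite bright_bright; have -> : i + (j - i.+1).+1 = j by lia.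
have lt' : j < size (bleft z i).2 by rewrite size_bleft.
have [Sl|Sb] := coX _ j lt' Xl; first by left; rewrite bleft_bleft in Sl; rewrite // ltnW.
right; apply: (@concats_cat _ (bright z j) (i - j.+1)).
- exact: string_bright.
- by rewrite size_bright; lia.
- by rewrite -bright_bleft.
- by rewrite bright_bright; have -> : j + (i - j.+1).+1 = i by lia.
Qed.

(** * Joins of biclosed sets *)

Definition Union (F : set (set rstr)) : set rstr := fun z => exists2 Y, F Y & Y z.

Lemma Union_strset F : (forall Y, F Y -> biclosed Y) -> strset (Union F).
Proof.
move=> bF; split=> z [Y FY Yz]; first exact: (bF _ FY).1.1.
by exists Y => //; apply: (bF _ FY).1.2.
Qed.

(** A break of a string in some member has a side in that same member, so the closure of the union
    is already biclosed. *)
Lemma concats_Union_is_join F : (forall Y, F Y -> biclosed Y) ->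
  is_join s t R F (concats (Union F)).
Proof.
move=> bF; split; [|split].
- apply: concats_biclosed; first exact: Union_strset.
  move=> z j lt [Y FY Yz]; have /biclosedP[_ _ coY] := bF _ FY.
  by have [Yl|Yr] := coY z j lt Yz; [left|right]; apply: concats_base; exists Y.
- by move=> Y FY z Yz; apply: concats_base; exists Y.
- move=> Z bZ FZ; have /biclosedP[_ cZ _] := bZ.
  by apply: concats_min => // z [Y FY Yz]; apply: (FZ Y).
Qed.

Lemma is_join_unique F x y : is_join s t R F x -> is_join s t R F y -> x = y.
Proof.
by move=> [bx [ux lx]] [by_ [uy ly]]; apply/seteqP; split; [apply: lx|apply: ly].
Qed.

Definition unbreakable X w := forall j, j < size w.2 ->
  X (bleft w j) -> X (bright w j) -> False.

Lemma unbreakable_rinv X w : strset X -> is_string w ->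
  unbreakable X w -> unbreakable X (rinv w).
Proof.
move=> [Xs Xi] ws nb j lt Xl Xr; rewrite size_rinv in lt.
have lt' : size w.2 - j.+1 < size w.2 by lia.
have E : size w.2 - (size w.2 - j.+1).+1 = j by lia.
apply: (nb _ lt').
  have := rinv_bleft ws lt'; rewrite E => e.
  by rewrite -(rinvK (string_bleft _ ws)) e; apply: Xi.
have := rinv_bright ws lt'; rewrite E => e.
by rewrite -(rinvK (string_bright _ ws)) e; apply: Xi.
Qed.

(** Compare the end of the prefix [w] with the end of the first piece. If the piece ends inside [w],
    co-closedness of the remainder applies, one alternative being a break of [w] with both sides in
    [concats X]. If it ends beyond [w], the piece itself falls under the hypothesis on [X]. *)
Lemma concats_extension X w :
  strset X -> biclosed (concats X) -> unbreakable (concats X) w ->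
  (forall z j, X z -> j < size z.2 -> bleft z j = w -> concats X (bright z j)) ->
  forall z j, concats X z -> j < size z.2 -> bleft z j = w -> concats X (bright z j).
Proof.
move=> sX /biclosedP[_ _ co] nb base z j Sz lt E.
case: Sz lt E => {z} [z Xz lt E|z i zs lti Xl Sr lt E]; first exact: base.
case: (ltngtP i j) => [ij|ji|<- //].
  have lt' : j - i.+1 < size (bright z i).2 by rewrite size_bright; lia.
  have [] := co _ _ lt' Sr; last first.
    by rewrite bright_bright; have -> : i + (j - i.+1).+1 = j by lia.
  rewrite -bright_bleft // E => Sm; case: (nb i _ _ Sm).
    by rewrite -E size_bleft.
  by rewrite -E bleft_bleft 1?ltnW //; apply: concats_base.
have lt' : j < size (bleft z i).2 by rewrite size_bleft.
have Sm : concats X (bright (bleft z i) j).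
  by apply: (base _ _ Xl lt'); rewrite bleft_bleft // ltnW.
apply: (@concats_cat _ (bright z j) (i - j.+1)).
- exact: string_bright.
- by rewrite size_bright; lia.
- by rewrite -bright_bleft.
- by rewrite bright_bright; have -> : j + (i - j.+1).+1 = i by lia.
Qed.

(** * Strings of a brick gentle algebra repeat no vertex *)

Definition verts z : seq Q0 := z.1 :: map ltgt z.2.

Lemma endv_verts z : endv z \in verts z.
Proof. exact: mem_last. Qed.

Lemma verts_rinv z : is_string z -> verts (rinv z) = rev (verts z).
Proof.
rewrite is_stringE => zs; rewrite /verts /= [in RHS]lastI rev_rcons; congr (_ :: _).
rewrite map_rev -map_comp; congr rev.
case: z zs => x ls /= /andP[]; elim: ls x => [|l ls IH] x //= /eqP sl ss.
rewrite ltgt_inv sl; congr (_ :: _); apply: IH; last exact: path_sorted ss.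
by case: ls ss => //= m ls /andP[/and4P[]].
Qed.

Lemma verts_streq z z' : is_string z' -> streq z z' -> verts z =i verts z'.
Proof. by move=> zs [] -> // v; rewrite verts_rinv // mem_rev. Qed.

Lemma verts_break z j : is_string z -> j < size z.2 ->
  verts z = verts (bleft z j) ++ verts (bright z j).
Proof.
move=> zs lt; case: z zs lt => x [|l0 ls] // zs lt.
have [_ E] := string_nth_break l0 zs lt; rewrite {3}/verts -E /verts.
rewrite -[in LHS](cat_take_drop j (x, l0 :: ls).2) map_cat.
by rewrite [in LHS](drop_nth l0 lt).
Qed.

(** * A representation supported on a closed walk *)

Section Cycle.
Variable k : fieldType.
Local Open Scope ring_scope.

(** The matrix unit E_01 in any size; indices are compared as natural numbers, and the matrix is
    zero when there is no column 1. *)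
Definition Emx p q : 'M[k]_(p, q) :=
  \matrix_(i, j) ((i == 0 :> nat) && (j == 1 :> nat))%:R.
Definition Imx p q : 'M[k]_(p, q) := \matrix_(i, j) (i == j :> nat)%:R.

Lemma mul_row_delta p q (F : nat -> bool) (j : 'I_q) :
  \sum_(l < p) (F l)%:R * (l == j :> nat)%:R = ((j < p)%N && F j)%:R :> k.
Proof.
have [lt|ge] := ltnP j p; last first.
  rewrite big1 // => l _; have -> : (l == j :> nat) = false; last by rewrite mulr0.
  by apply/eqP => E; move: (ltn_ord l); rewrite E ltnNge ge.
rewrite (bigD1 (Ordinal lt)) //= eqxx mulr1 big1 ?addr0 // => l ne.
have -> : (l == j :> nat) = false; last by rewrite mulr0.
by apply/eqP => E; case/eqP: ne; apply: val_inj.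
Qed.

Lemma mulmx_Imx m p q (F : nat -> nat -> bool) :
  (\matrix_(i < m, l < p) (F i l)%:R) *m Imx p q =
  \matrix_(i, j) ((j < p)%N && F i j)%:R.
Proof.
apply/matrixP => i j; rewrite !mxE -(mul_row_delta _ (F i)).
by apply: eq_bigr => l _; rewrite !mxE.
Qed.

(** The side condition ensures that the middle dimension truncates no entry that both outer ones
    keep. *)
Lemma Imx_Imx m p q : ((q <= p) || (m <= p))%N -> Imx m p *m Imx p q = Imx m q.
Proof.
move=> le; rewrite (mulmx_Imx _ _ _ (fun i l => i == l)).
apply/matrixP => i j; rewrite !mxE.
congr (_ %:R); congr nat_of_bool; have := ltn_ord i; have := ltn_ord j.
by case: eqP => E; rewrite ?andbF ?andbT //; lia.
Qed.

Lemma Imx1 n : Imx n n = 1%:M.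
Proof. by apply/matrixP => i j; rewrite !mxE. Qed.

Lemma Emx_Imx m p q : (q <= p)%N -> Emx m p *m Imx p q = Emx m q.
Proof.
move=> le; rewrite (mulmx_Imx _ _ _ (fun i l => (i == 0) && (l == 1)))%N.
apply/matrixP => i j; rewrite !mxE.
by have -> : (j < p)%N by apply: leq_trans le.
Qed.

Lemma Emx_Imx0 m p q : (q <= 1)%N -> Emx m p *m Imx p q = 0.
Proof.
move=> le; rewrite (mulmx_Imx _ _ _ (fun i l => (i == 0) && (l == 1)))%N.
apply/matrixP => i j; rewrite !mxE.
have -> : (j == 1 :> nat) = false by have := ltn_ord j; lia.
by rewrite !andbF.
Qed.

Lemma Imx_Emx m p q : (0 < p)%N -> Imx m p *m Emx p q = Emx m q.
Proof.
move=> p0; apply/matrixP => i j; rewrite !mxE.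
rewrite (bigD1 (Ordinal p0)) //= big1 ?addr0 => [|l ne]; rewrite !mxE /=.
  by do 2 case: (_ == _ :> nat); rewrite ?mulr0 ?mulr1.
have -> : (l == 0 :> nat) = false; last by rewrite mulr0.
by apply/eqP => E; case/eqP: ne; apply: val_inj.
Qed.

Lemma Emx_Emx m p q : Emx m p *m Emx p q = 0.
Proof.
apply/matrixP => i j; rewrite !mxE big1 // => l _; rewrite !mxE.
by case: eqP => _ //=; rewrite ?mul0r //; case: (l : nat) => [|n]; rewrite ?mul0r ?mulr0.
Qed.

Variables (x : Q0) (l0 : letter) (ls : seq letter).
Let p := l0 :: ls.
Let d := size p.
Let L i := nth l0 p i.
Let v i := nth x (x :: map ltgt p) i.
Let la := (L d.-1).1.
Let arrows := map fst p.

Hypothesis ps : is_string (x, p).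
Hypothesis up : uniq (map ltgt p).
Hypothesis loop : endv (x, p) = x.

Lemma cyc_tgt i : (i < d)%N -> ltgt (L i) = v i.+1.
Proof. by move=> lt; rewrite -[RHS]/(nth x (map ltgt p) i) (nth_map l0). Qed.

Lemma cyc_follows i : (i.+1 < d)%N -> follows (L i) (L i.+1).
Proof. by move: ps; rewrite is_stringE => /andP[_ /(sortedP l0)]; apply. Qed.

Lemma cyc_src i : (i < d)%N -> lsrc (L i) = v i.
Proof.
case: i => [_|i lt]; first by move: ps; rewrite is_stringE => /andP[/eqP].
by have /and4P[/eqP -> _ _ _] := cyc_follows lt; apply/cyc_tgt/ltnW.
Qed.

Lemma cyc_inj i j : (0 < i <= d)%N -> (0 < j <= d)%N -> v i = v j -> i = j.
Proof.
case: i => // i; case: j => // j lti ltj /= E; congr S; apply/eqP.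
by rewrite -(nth_uniq x _ _ up) ?size_map //; apply/eqP.
Qed.

Lemma cyc_end : v d = x.
Proof. by rewrite -[RHS]loop /v /Defs.endv (last_nth x) size_map. Qed.

(** Positions 0 and d carry the same vertex [x], so injectivity on positions 1 to d transfers to 0
    to d-1. *)
Lemma cyc_inj0 i j : (i < d)%N -> (j < d)%N -> v i = v j -> i = j.
Proof.
case: i => [|i]; case: j => [|j] // lti ltj E; last by apply: cyc_inj E; lia.
  have Ed : d = j.+1 by apply: cyc_inj (etrans cyc_end E); lia.
  by lia.
have Ed : d = i.+1 by apply: cyc_inj (etrans cyc_end (esym E)); lia.
by lia.
Qed.

(** Two occurrences in the same direction share their target. Two in opposite directions have target
    equal to source, hence are consecutive, which is a backtrack. *)
Lemma cyc_arrow_inj i j : (i < d)%N -> (j < d)%N -> (L i).1 = (L j).1 -> i = j.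
Proof.
wlog ltij : i j / (i < j)%N.
  move=> H lti ltj E; case: (ltngtP i j) => [h|h|//]; first exact: H.
  by apply/esym/H.
move=> lti ltj E.
have [Ed|nEd] := eqVneq (L i).2 (L j).2.
  have Et : ltgt (L i) = ltgt (L j) by rewrite /Defs.ltgt E Ed.
  rewrite !cyc_tgt // in Et.
  have Eij : i.+1 = j.+1 by apply: cyc_inj Et; lia.
  by case: Eij.
have Et : ltgt (L i) = lsrc (L j).
  by rewrite /Defs.ltgt /Defs.lsrc E; case: (L i).2 (L j).2 nEd => [] [].
rewrite cyc_tgt // cyc_src // in Et.
have Ej : i.+1 = j by apply: cyc_inj Et; lia.
subst j; have /and4P[_ nb _ _] := cyc_follows ltj.
by rewrite E eqxx nEd in nb.
Qed.

Lemma arrowsP a : a \in arrows -> exists2 i, (i < d)%N & a = (L i).1.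
Proof.
move=> /(nthP l0.1)[i]; rewrite size_map => lt <-; exists i => //.
by rewrite (nth_map l0).
Qed.

Lemma mem_arrows i : (i < d)%N -> (L i).1 \in arrows.
Proof. by move=> lt; apply/map_f/mem_nth. Qed.

Lemma not_last i : (i < d.-1)%N -> (L i).1 != la.
Proof.
move=> lt; apply/eqP => /cyc_arrow_inj; lia.
Qed.

Hypothesis relations : forall a b, R a b -> t a = s b.

(** The equality [t a = s b] fixes the positions of the two letters: opposite directions would put
    both at one position, and equal directions make them consecutive. Inside the walk [follows]
    forbids this, which leaves the junction at [x]. *)
Lemma cyc_relation a b : R a b -> a \in arrows -> b \in arrows ->
  (a = la /\ b = l0.1 /\ (L d.-1).2 /\ l0.2) \/
  (a = l0.1 /\ b = la /\ ~~ l0.2 /\ ~~ (L d.-1).2).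
Proof.
move=> Rab /arrowsP[i lti Ea] /arrowsP[j ltj Eb]; have := relations Rab.
have tgi := cyc_tgt lti; have sri := cyc_src lti.
have tgj := cyc_tgt ltj; have srj := cyc_src ltj.
have [di|ni] := boolP (L i).2; have [dj|nj] := boolP (L j).2.
- have -> : t a = v i.+1 by rewrite -tgi /Defs.ltgt di Ea.
  have -> : s b = v j by rewrite -srj /Defs.lsrc dj Eb.
  case: j ltj Eb dj {tgj srj} => [|j] ltj Eb dj E.
    left; have Ei : i.+1 = d by apply: cyc_inj (etrans E (esym cyc_end)); lia.
    have Ei' : d.-1 = i by lia.
    by rewrite /la Ei'.
  have Ei : i.+1 = j.+1 by apply: cyc_inj E; lia.
  case: Ei => Ei; subst j; have /and4P[_ _ nR _] := cyc_follows ltj.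
  by rewrite di dj -Ea -Eb Rab in nR.
- have -> : t a = v i.+1 by rewrite -tgi /Defs.ltgt di Ea.
  have -> : s b = v j.+1 by rewrite -tgj /Defs.ltgt (negbTE nj) Eb.
  move=> E; have Ei : i.+1 = j.+1 by apply: cyc_inj E; lia.
  by case: Ei => Ei; move: nj; rewrite -Ei di.
- have -> : t a = v i by rewrite -sri /Defs.lsrc (negbTE ni) Ea.
  have -> : s b = v j by rewrite -srj /Defs.lsrc dj Eb.
  by move=> E; move: ni; rewrite (cyc_inj0 lti ltj E) dj.
- have -> : t a = v i by rewrite -sri /Defs.lsrc (negbTE ni) Ea.
  have -> : s b = v j.+1 by rewrite -tgj /Defs.ltgt (negbTE nj) Eb.
  case: i lti Ea ni {tgi sri} => [|i] lti Ea ni E.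
    right; have Ej : d = j.+1 by apply: cyc_inj (etrans cyc_end E); lia.
    have Ej' : d.-1 = j by lia.
    by rewrite /la Ej'.
  have Ei : i.+1 = j.+1 by apply: cyc_inj E; lia.
  case: Ei => Ei; subst j; have /and4P[_ _ _ nR] := cyc_follows lti.
  by rewrite ni nj -Ea -Eb Rab in nR.
Qed.

Variable r : nat.
Hypothesis r12 : (0 < r <= 2)%N.
Let dm (y : Q0) : nat := if y == x then 2%N else if y \in map ltgt p then r else 0%N.

Lemma dmx : dm x = 2%N. Proof. by rewrite /dm eqxx. Qed.

Lemma dm_le2 y : (dm y <= 2)%N.
Proof. by rewrite /dm; case: eqP => // _; case: ifP => // _; case/andP: r12. Qed.

Lemma dm_v i : (0 < i < d)%N -> dm (v i) = r.
Proof.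
move=> lt; rewrite /dm; case: eqP => [E|_].
  by rewrite -cyc_end in E; have := cyc_inj _ _ E; lia.
have -> // : v i \in map ltgt p.
case: i lt => // i lt; rewrite -[v i.+1]/(nth x (map ltgt p) i).
by rewrite mem_nth // size_map; apply: ltnW; case/andP: lt.
Qed.

Lemma dm_v_gt0 i : (i < d)%N -> (0 < dm (v i))%N.
Proof.
by case: i => [|i] lt; [rewrite /v /= dmx | rewrite dm_v //; case/andP: r12].
Qed.

Lemma dm_v_ge i : (i < d)%N -> (r <= dm (v i))%N.
Proof.
by case: i => [|i] lt; [rewrite /v /= dmx; case/andP: r12 | rewrite dm_v //].
Qed.

(* The walk is either a band, or it may be closed at [x] by a relation between its
   last and first arrows.  The representation [cycle_rep] has k^2 at [x] and k^r at
   the other vertices of the walk; the last arrow acts by the matrix unit E_01, the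
   other arrows by (truncated) identities, and E_01 is an endomorphism. *)
Hypothesis closing :
  (r = 2%N /\ forall a b, a \in arrows -> b \in arrows -> ~~ R a b) \/
  (r = 1%N /\ l0.2 /\ (L d.-1).2).

Definition cycle_map (a : Q1) (y y' : Q0) : 'M[k]_(dm y, dm y') :=
  if a == la then Emx _ _ else if a \in arrows then Imx _ _ else 0.

Definition cycle_rep : rep Q0 Q1 k := Rep cycle_map.

(** The dimension can drop only along the first letter, and only when [r] is 1; that letter is then
    direct. *)
Lemma id_letter i : (i < d.-1)%N -> (dm (ltgt (L i)) <= dm (lsrc (L i)))%N /\
  (~~ (L i).2 || (r == 2%N) -> (dm (lsrc (L i)) <= dm (ltgt (L i)))%N).
Proof.
move=> lt; rewrite cyc_tgt ?cyc_src; try lia.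
rewrite (@dm_v i.+1); last lia.
split; first by apply: dm_v_ge; lia.
case: i lt => [|i] lt; last by rewrite dm_v; lia.
rewrite /v /= dmx; case: closing => [[-> //]|[-> [l0d _]]].
by rewrite /L /= l0d.
Qed.

Lemma id_arrow a : a \in arrows -> a != la -> (dm (t a) <= dm (s a))%N.
Proof.
move=> /arrowsP[i lti ->] ne.
have lt : (i < d.-1)%N.
  by rewrite ltn_neqAle -ltnS (ltn_predK lti) lti andbT; apply: contra ne => /eqP ->.
have [] := id_letter lt; rewrite /Defs.ltgt /Defs.lsrc.
by case: (L i).2 => //= _; apply.
Qed.

Lemma cycle_rep_bound : bound_rep s t R cycle_rep.
Proof.
move=> a b Rab /=; rewrite /cycle_map.
have [aA|aN] := boolP (a \in arrows); last first.
  have -> : (a == la) = false.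
    by apply: contraNF aN => /eqP ->; apply: mem_arrows; rewrite /d /=.
  by rewrite mul0mx.
have [bA|bN] := boolP (b \in arrows); last first.
  have -> : (b == la) = false.
    by apply: contraNF bN => /eqP ->; apply: mem_arrows; rewrite /d /=.
  by rewrite mulmx0.
have [[_ /(_ a b aA bA)]|[r1 [l0d lad]]] := closing; first by rewrite Rab.
have [[-> [-> _]]|[_ [_ [/negP[]]]]] // := cyc_relation Rab aA bA.
(* If the walk has a single letter, both maps are E_01, whose square is zero. Otherwise the first
   arrow truncates to dimension [r], equal to 1, which kills column 1 of E_01. *)
rewrite eqxx; case: eqP => [_|/eqP ne]; first exact: Emx_Emx.
apply: Emx_Imx0; have d1 : (0 < d.-1)%N.
  by move: ne; rewrite /la /d /L /=; case: (size ls) => //=; rewrite eqxx.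
have -> : t l0.1 = v 1 by rewrite -(@cyc_tgt 0) // /Defs.ltgt /L /= l0d.
by rewrite dm_v ?r1 //; lia.
Qed.

Definition cycle_endo y : 'M[k]_(dm y) := Emx _ _.

Lemma cycle_endo_is_endo : is_endo s t (M := cycle_rep) cycle_endo.
Proof.
move=> a /=; rewrite /cycle_map /cycle_endo.
case: eqP => [_|/eqP ne]; first by rewrite !Emx_Emx.
case: ifP => [aA|_]; last by rewrite mul0mx mulmx0.
have le := id_arrow aA ne; rewrite Emx_Imx //.
have [s0|s0] := posnP (dm (s a)); last first.
  have [t0|t0] := posnP (dm (t a)); last by rewrite Imx_Emx.
  by apply/matrixP => i j; have lt := ltn_ord j; exfalso; lia.
by apply/matrixP => i j; have lt := ltn_ord i; exfalso; lia.
Qed.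

Lemma cycle_endo_neq0 : cycle_endo x != 0.
Proof.
apply/eqP => E; have : Imx 2 (dm x) *m cycle_endo x *m Imx (dm x) 2 = 0.
  by rewrite E mulmx0 mul0mx.
rewrite Imx_Emx ?dmx // Emx_Imx // => /matrixP/(_ ord0 (lift ord0 ord0)).
by rewrite !mxE /= => /eqP; rewrite oner_eq0.
Qed.

Lemma cycle_rep_not_division : ~ end_division s t cycle_rep.
Proof.
move=> /(_ cycle_endo cycle_endo_is_endo) [|g [_ gP]].
  by exists x; apply: cycle_endo_neq0.
have [fg _] := gP x; have := cycle_endo_neq0.
by rewrite -[cycle_endo x]mulmx1 -fg mulmxA Emx_Emx mul0mx eqxx.
Qed.

(** Rows of length two serve as common coordinates at all vertices, truncated where the dimension is
    smaller. In these coordinates the arrows acting by identities leave [c] unchanged. *)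
Definition holds_at (U : forall y, 'M[k]_(dm y)) y (c : 'rV[k]_2) :=
  (c *m Imx 2 (dm y) <= U y)%MS.

Section Decomposition.
Variables U V : forall y, 'M[k]_(dm y).
Hypotheses (sU : subrep s t (M := cycle_rep) U) (sV : subrep s t (M := cycle_rep) V).
Hypothesis UV : forall y, (U y + V y == 1%:M)%MS /\ (U y :&: V y)%MS = 0.

Lemma decompose y c : exists cu cv, [/\ holds_at U y cu, holds_at V y cv &
  c *m Imx 2 (dm y) = (cu + cv) *m Imx 2 (dm y)].
Proof.
have lift_row (w : 'rV_(dm y)) : w *m Imx (dm y) 2 *m Imx 2 (dm y) = w.
  by rewrite -mulmxA Imx_Imx ?leqnn ?Imx1 ?mulmx1 // dm_le2.
have : (c *m Imx 2 (dm y) <= U y + V y)%MS.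
  by rewrite (eqmxP (UV y).1) submx1.
case/sub_addsmxP => -[u w] /= E.
exists (u *m U y *m Imx _ 2), (w *m V y *m Imx _ 2).
rewrite /holds_at mulmxDl !lift_row E; split=> //; exact: submxMl.
Qed.

Lemma holds_disjoint y c : holds_at U y c -> holds_at V y c -> c *m Imx 2 (dm y) = 0.
Proof.
by move=> hU hV; apply/eqP; rewrite -submx0 -(UV y).2 sub_capmx; apply/andP.
Qed.

Lemma holds_id a c : a \in arrows -> a != la -> holds_at U (s a) c -> holds_at U (t a) c.
Proof.
move=> aA ne h; have := submx_trans (submxMr _ h) (sU a).
by rewrite /= /cycle_map (negbTE ne) aA -mulmxA Imx_Imx // id_arrow.
Qed.

Lemma holds_last c : holds_at U (s la) c -> holds_at U (t la) (c *m Emx 2 2).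
Proof.
move=> h; have := submx_trans (submxMr _ h) (sU la).
rewrite /= /cycle_map eqxx /holds_at -!mulmxA Imx_Emx ?Emx_Imx ?dm_le2 //.
have lt : (d.-1 < d)%N by rewrite /d.
have lt' : (0 < d)%N by rewrite /d.
have := cyc_src lt; have := cyc_tgt lt; rewrite /Defs.lsrc /Defs.ltgt -/la.
case: (L d.-1).2 => Et Es; first by rewrite Es; exact: dm_v_gt0.
by rewrite Et prednK // cyc_end dmx.
Qed.
End Decomposition.

(** Decompose [c] at the source. The image of its V-part lies in both U and V at the target, so it
    vanishes; the dimension hypothesis makes the arrow injective, so the V-part itself vanishes. *)
Lemma holds_id_rev U V a c :
  subrep s t (M := cycle_rep) U -> subrep s t (M := cycle_rep) V ->
  (forall y, (U y + V y == 1%:M)%MS /\ (U y :&: V y)%MS = 0) ->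
  a \in arrows -> a != la -> (dm (s a) <= dm (t a))%N ->
  holds_at U (t a) c -> holds_at U (s a) c.
Proof.
move=> sU sV UV aA ne le h; have le' := id_arrow aA ne.
have [cu [cv [hu hv E]]] := decompose UV (s a) c.
have hu' := holds_id sU aA ne hu; have hv' := holds_id sV aA ne hv.
have E' : c *m Imx 2 (dm (t a)) = (cu + cv) *m Imx 2 (dm (t a)).
  by rewrite -!(@Imx_Imx 2 (dm (s a)) (dm (t a))) ?le' // !mulmxA E.
have : holds_at U (t a) cv.
  have -> : holds_at U (t a) cv = ((c - cu) *m Imx 2 (dm (t a)) <= U (t a))%MS.
    by rewrite /holds_at mulmxBl E' mulmxDl addrAC subrr add0r.
  by rewrite mulmxBl addmx_sub // eqmx_opp.
move=> /holds_disjoint/(_ hv') => /(_ UV) /(congr1 (mulmx^~ (Imx _ (dm (s a))))).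
rewrite mul0mx -mulmxA Imx_Imx ?le // => cv0.
by rewrite /holds_at E mulmxDl cv0 addr0.
Qed.

Lemma holds_letter U V i c :
  subrep s t (M := cycle_rep) U -> subrep s t (M := cycle_rep) V ->
  (forall y, (U y + V y == 1%:M)%MS /\ (U y :&: V y)%MS = 0) -> (i < d.-1)%N ->
  (holds_at U (v i) c -> holds_at U (v i.+1) c) /\
  (r = 2%N -> holds_at U (v i.+1) c -> holds_at U (v i) c).
Proof.
move=> sU sV UV lt; have ne := not_last lt.
have aA : (L i).1 \in arrows by apply: mem_arrows; lia.
have [le1 le2] := id_letter lt.
have <- : ltgt (L i) = v i.+1 by apply: cyc_tgt; lia.
have <- : lsrc (L i) = v i by apply: cyc_src; lia.
move: le1 le2; rewrite /Defs.ltgt /Defs.lsrc; case: (L i).2 => /= le1 le2.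
  split; first exact: holds_id.
  by move=> r2; apply: (holds_id_rev sU sV UV) => //; apply: le2; rewrite r2.
by split=> [|_]; [apply: (holds_id_rev sU sV UV) | apply: holds_id].
Qed.

Lemma holds_path U V i c :
  subrep s t (M := cycle_rep) U -> subrep s t (M := cycle_rep) V ->
  (forall y, (U y + V y == 1%:M)%MS /\ (U y :&: V y)%MS = 0) -> (i < d)%N ->
  (holds_at U x c -> holds_at U (v i) c) /\
  (r = 2%N -> holds_at U (v i) c -> holds_at U x c).
Proof.
move=> sU sV UV; elim: i => [|i IH] lt; first by [].
have [h1 h2] := IH (ltnW lt).
have [|h3 h4] := @holds_letter U V i c sU sV UV; first by lia.
by split=> [/h1/h3 //|r2 /(h4 r2)]; apply: h2.
Qed.

(** Carry [c] once around the walk. If the last letter is direct, follow the walk and then apply the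
    last arrow; if it is inverse, apply that arrow first and return along the walk, which is
    possible since [r] is then 2. *)
Lemma holds_nilpotent U V c :
  subrep s t (M := cycle_rep) U -> subrep s t (M := cycle_rep) V ->
  (forall y, (U y + V y == 1%:M)%MS /\ (U y :&: V y)%MS = 0) ->
  holds_at U x c -> holds_at U x (c *m Emx 2 2).
Proof.
move=> sU sV UV h; have lt : (d.-1 < d)%N by rewrite /d.
have := cyc_src lt; have := cyc_tgt lt; have := @holds_last U sU.
rewrite /Defs.lsrc /Defs.ltgt -/la prednK // cyc_end.
have [ld|ln] := boolP (L d.-1).2 => hl Et Es.
  by rewrite -Et; apply: hl; rewrite Es; apply: (holds_path _ sU sV UV lt).1.
have r2 : r = 2%N by case: closing ln => [[] //|[_ [_ ->]]].
apply: (holds_path _ sU sV UV lt).2 => //.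
by rewrite -Es; apply: hl; rewrite Et.
Qed.

Lemma holds_vanish U V c :
  subrep s t (M := cycle_rep) U -> subrep s t (M := cycle_rep) V ->
  (forall y, (U y + V y == 1%:M)%MS /\ (U y :&: V y)%MS = 0) ->
  holds_at U x c -> c 0 0 != 0 -> forall y, V y = 0.
Proof.
move=> sU sV UV h c0; have hN := holds_nilpotent sU sV UV h.
have full c' : holds_at U x c'.
  (* The row [c *m Emx 2 2] is (0, c_0), so together with [c] it is a basis; the coefficients solve
     the resulting triangular system. *)
  have -> : c' = (c' 0 0 / c 0 0) *: c +
      ((c' 0 (lift ord0 ord0) - c' 0 0 / c 0 0 * c 0 (lift ord0 ord0)) / c 0 0) *:
      (c *m Emx 2 2).
    have N i : (c *m Emx 2 2) 0 i = c 0 0 * (i == 1 :> nat)%:R.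
      by rewrite mxE !big_ord_recl big_ord0 !mxE /= mulr0 !addr0.
    apply/rowP => i; rewrite mxE [X in _ = X + _]mxE [X in _ = _ + X]mxE N.
    case: (unliftP ord0 i) => [j ->|->] /=.
      by rewrite (ord1 j) mulr1 divfK // addrC subrK.
    by rewrite !mulr0 addr0 divfK.
  rewrite /holds_at mulmxDl -!scalemxAl addmx_sub // scalemx_sub //.
have fullv y : y \in v 0 :: map ltgt p -> V y = 0.
  move=> yin; have [i lt ->] : exists2 i, (i < d)%N & y = v i.
    move: yin; rewrite inE => /orP[/eqP ->|]; first by exists 0%N.
    move=> /(nthP x)[i]; rewrite size_map => lt <-; have [Ei|ne] := eqVneq i.+1 d.
      by exists 0%N => //; rewrite -[RHS]cyc_end -Ei.
    by exists i.+1; rewrite // ltn_neqAle ne.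
  have fu c' : holds_at U (v i) c' := (holds_path c' sU sV UV lt).1 (full c').
  apply/eqP; rewrite -submx0 -(UV (v i)).2 sub_capmx submx_refl andbT.
  apply/row_subP => j; have := fu (row j (V (v i)) *m Imx _ 2).
  by rewrite /holds_at -mulmxA Imx_Imx ?Imx1 ?mulmx1 // dm_le2.
move=> y; have [/fullv //|] := boolP (y \in v 0 :: map ltgt p).
rewrite inE negb_or => /andP[nx np]; have d0 : dm y = 0%N.
  by rewrite /dm (negbTE nx) (negbTE np).
apply/matrixP => i; have dm_gt0 := leq_ltn_trans (leq0n i) (ltn_ord i).
by rewrite /= d0 in dm_gt0.
Qed.

(** Split the first basis vector at [x]: one of its two parts has nonzero coordinate 0, and then
    [holds_vanish] annihilates the other summand. *)
Lemma cycle_rep_indecomposable : indecomposable s t cycle_rep.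
Proof.
split; first by exists x; rewrite /= dmx.
move=> U V sU sV UV.
have [cu [cv [hu hv E]]] := decompose UV x (delta_mx 0 0).
have {}E : delta_mx 0 0 = cu + cv.
  have := congr1 (mulmx^~ (Imx (dm x) 2)) E.
  by rewrite -!mulmxA Imx_Imx ?dmx // Imx1 !mulmx1.
have [cu0|cu0] := eqVneq (cu 0 0) 0; last by right; apply: holds_vanish hu cu0.
left; have VU y : (V y + U y == 1%:M)%MS /\ (V y :&: U y)%MS = 0.
  by have [e1 e2] := UV y; rewrite addsmxC capmxC.
apply: (holds_vanish sV sU VU hv).
have := congr1 (fun c : 'rV_2 => c 0 0) E; rewrite !mxE cu0 add0r => <-.
by rewrite oner_eq0.
Qed.

End Cycle.

(** Otherwise [closing] holds, with [r] equal to 1 if the first and last letters are both direct and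
    to 2 if no relation occurs, and [cycle_rep] contradicts the brick condition. *)
Lemma closed_walk_relation (k : fieldType) x (l0 : letter) (ls : seq letter) :
  brick_gentle s t R k -> is_string (x, l0 :: ls) -> uniq (map ltgt (l0 :: ls)) ->
  endv (x, l0 :: ls) = x ->
  [&& ~~ l0.2, ~~ (last l0 ls).2 & R l0.1 (last l0 ls).1].
Proof.
move=> [[[rel _] _] brick] ps up loop.
have El : nth l0 (l0 :: ls) (size (l0 :: ls)).-1 = last l0 ls.
  by rewrite (last_nth l0).
have nb r : (0 < r <= 2)%N ->
    ~ ((r = 2 /\ forall a b, a \in map fst (l0 :: ls) ->
          b \in map fst (l0 :: ls) -> ~~ R a b) \/
       (r = 1 /\ l0.2 /\ (last l0 ls).2)).
  move=> r12 cl; rewrite -El in cl.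
  have nd := cycle_rep_not_division (k := k) ps up loop r12 cl.
  have bd := cycle_rep_bound k ps up loop rel r12 cl.
  exact/nd/(brick _ bd)/(cycle_rep_indecomposable k ps up loop r12 cl).
apply: contrapT => /negP nw2.
have [dd|ndd] := boolP (l0.2 && (last l0 ls).2).
  by case/andP: dd => d0 dl; apply: (@nb 1) => //; right.
apply: (@nb 2) => //; left; split=> // a b aA bA; apply/negP => Rab.
have := cyc_relation ps up loop rel Rab aA bA; rewrite El.
case=> [[_ [_ [dl d0]]]|[Ea [Eb [n0 nl]]]]; first by rewrite d0 dl in ndd.
by case/negP: nw2; rewrite n0 nl -Ea -Eb.
Qed.

(* A shortest string repeating a vertex is a closed walk, and so is its inverse; but
   [closed_walk_relation] cannot hold for both. *)
Lemma string_verts_uniq (k : fieldType) : brick_gentle s t R k ->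
  forall z, is_string z -> uniq (verts z).
Proof.
move=> bg z; have [n] := ubnP (size z.2); elim: n z => // n IH z lt zs.
apply: contrapT => /negP nu.
(* Deleting the first or the last letter leaves a shorter string, which repeats no vertex by
   induction; hence the only repetition is between the two endpoints. *)
have closed_walk y : size y.2 = size z.2 -> is_string y -> ~~ uniq (verts y) ->
    uniq (map ltgt y.2) /\ endv y = y.1.
  case: y => x p sz ys nuy.
  case: p sz ys nuy => [|l p] // sz ys nuy.
  have lt0 : 0 < size (x, l :: p).2 by [].
  have up : uniq (map ltgt (l :: p)).
    have := IH (bright (x, l :: p) 0) _ (string_bright _ ys).
    have := verts_break ys lt0; rewrite /bleft /= => -[E1 E2].
    rewrite /verts /= E1 -E2; apply; rewrite /= drop0.
    by move: lt; rewrite -sz /=; lia.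
  split=> //; move: nuy.
  have -> : uniq (verts (x, l :: p)) =
      (x \notin map ltgt (l :: p)) && uniq (map ltgt (l :: p)) by [].
  rewrite up andbT negbK => xin; have ltp : size (l :: p) < n.+1 by move: lt; rewrite -sz.
  move: ys xin ltp; case/lastP: (l :: p) => [|q l'] // ys xin.
  rewrite size_rcons ltnS => ltq; rewrite /Defs.endv map_rcons last_rcons.
  move: xin; rewrite map_rcons mem_rcons inE => /orP[/eqP //|xq].
  have := string_bleft (size q) ys; rewrite /bleft /= -cats1 take_size_cat // => qs.
  by have /andP[/negP[]] := IH (x, q) ltq qs.
have [up loop] := closed_walk z erefl zs nu.
have [up' loop'] : uniq (map ltgt (rinv z).2) /\ endv (rinv z) = (rinv z).1.
  apply: closed_walk; [exact: size_rinv | exact: is_string_rinv |].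
  by rewrite verts_rinv // rev_uniq.
have zs' := is_string_rinv zs.
case: z {lt closed_walk} zs nu up loop zs' up' loop' => x [|l0 ls] // zs _ up loop.
have /and3P[n0 nl _] := closed_walk_relation bg zs up loop.
rewrite /Defs.rinv loop /=.
case/lastP: ls zs up loop n0 nl => [|q l] zs up loop n0 nl.
  move=> zs' up' loop'; have /and3P[] := closed_walk_relation bg zs' up' loop'.
  by rewrite /= negbK (negbTE n0).
rewrite map_rcons rev_cons rev_rcons rcons_cons => zs' up' loop'.
have /and3P[] := closed_walk_relation bg zs' up' loop'.
by rewrite last_rcons in nl; rewrite /= negbK (negbTE nl).
Qed.

(** * Removing a string from a biclosed set *)

Hypothesis avoid : forall z, is_string z -> uniq (verts z).

Lemma break_disjoint z j (v : Q0) : is_string z -> j < size z.2 ->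
  v \in verts (bleft z j) -> v \in verts (bright z j) -> False.
Proof.
move=> zs lt vl vr; have := avoid zs; rewrite (verts_break zs lt) cat_uniq.
by case/and3P=> _ /hasPn/(_ v vr); rewrite vl.
Qed.

Lemma endv_bright z j : is_string z -> j < size z.2 -> endv (bright z j) = endv z.
Proof.
move=> zs lt; have E : endv z = last z.1 (verts z) by [].
by rewrite E (verts_break zs lt) last_cat.
Qed.

Definition remove X w : set rstr := fun z => X z /\ ~ streq z w.

(** Closedness survives because no break of [w] has both sides in [X]. For co-closedness, if one
    side of a break is [w], the other lies in [X] by the extension hypothesis, and it is not [w]
    because no vertex repeats. *)
Lemma remove_biclosed X w : biclosed X -> is_string w -> unbreakable X w ->
  (forall w', streq w' w -> forall z j, X z -> j < size z.2 ->
     bleft z j = w' -> X (bright z j)) ->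
  biclosed (remove X w).
Proof.
move=> /biclosedP[sX cX coX] ws nb ext; apply/biclosedP.
have extL z j : X z -> j < size z.2 -> streq (bleft z j) w -> X (bright z j).
  by move=> Xz lt e; apply: (ext _ e).
have extR z j : X z -> j < size z.2 -> streq (bright z j) w -> X (bleft z j).
  move=> Xz lt e; have zs := sX.1 _ Xz.
  have lt' : size z.2 - j.+1 < size (rinv z).2 by rewrite size_rinv; lia.
  rewrite -(rinvK (string_bleft _ zs)); apply: sX.2; rewrite (rinv_bleft zs) //.
  apply: extL => //; first exact: sX.2.
  rewrite -(rinv_bright zs) //; apply: (streq_trans ws _ e).
  by right.
have disj z j : X z -> j < size z.2 -> streq (bleft z j) w -> ~ streq (bright z j) w.
  move=> Xz lt e1 e2; apply: (@break_disjoint z j w.1 (sX.1 _ Xz) lt).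
    by rewrite (verts_streq ws e1) mem_head.
  by rewrite (verts_streq ws e2) mem_head.
split.
- split=> z [Xz nz]; first exact: sX.1.
  split=> [|e]; first exact: sX.2.
  by apply: nz; apply: (streq_trans ws _ e); right; rewrite (rinvK (sX.1 _ Xz)).
- move=> z j zs lt [Xl nl] [Xr nr]; split=> [|]; first exact: cX lt Xl Xr.
  case=> E; subst z; first exact: (nb _ lt Xl Xr).
  exact: (unbreakable_rinv sX ws nb lt Xl Xr).
- move=> z j lt [Xz nz].
  have [el|nl] := pselect (streq (bleft z j) w).
    by right; split; [exact: extL | exact: disj el].
  have [er|nr] := pselect (streq (bright z j) w).
    by left; split=> //; exact: extR er.
  by have [Xl|Xr] := coX _ _ lt Xz; [left|right].
Qed.

(** * Labels and their join-irreducibles *)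

Local Notation valid_label := (valid_label s t R).
Local Notation Jgen := (Jgen s t R).
Local Notation J := (J s t R).
Local Notation is_split := (is_split s t).

Lemma split_string w u : is_string w -> is_split w u -> is_string u.
Proof.
move=> ws [j [lt [e|e]]]; apply: streq_string e.
  exact: string_bleft.
exact: string_bright.
Qed.

Lemma label_string w D u : valid_label w D -> u \in D -> is_string u.
Proof. by move=> [ws [_ [sp _]]] /sp; apply: split_string. Qed.

Lemma split_size w u : is_split w u -> size u.2 < size w.2.
Proof.
move=> [j [lt [/streq_size ->|/streq_size ->]]]; first by rewrite size_bleft.
by rewrite size_bright; lia.
Qed.

Lemma streq_rinvr z z' : is_string z' -> streq z z' -> streq z (rinv z').
Proof. by move=> zs [] ->; [right; rewrite (rinvK zs) | left]. Qed.

Lemma split_rinvl w u : is_string w -> is_split w u -> is_split (rinv w) u.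
Proof.
move=> ws [j [lt e]]; exists (size w.2 - j.+1).
rewrite size_rinv -(rinv_bleft ws lt) -(rinv_bright ws lt); split; first lia.
case: e => e; [right|left]; first exact: (streq_rinvr (string_bleft j ws)).
exact: (streq_rinvr (string_bright j ws)).
Qed.

Lemma split_streq w u v : is_string w -> streq u v -> is_split w v -> is_split w u.
Proof.
move=> ws e [j [lt ev]]; exists j; split=> //.
case: ev => ev; [left; apply: (streq_trans (string_bleft j ws) e ev)|right].
exact: (streq_trans (string_bright j ws) e ev).
Qed.

Lemma same_break_rinv w u v : is_string w ->
  same_break s t (rinv w) u v -> same_break s t w u v.
Proof.
move=> ws [j [lt e]]; rewrite size_rinv in lt; exists (size w.2 - j.+1).
have lt' : j < size (rinv w).2 by rewrite size_rinv.
have ws' := is_string_rinv ws.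
have := rinv_bleft ws' lt'; have := rinv_bright ws' lt'.
rewrite (rinvK ws) size_rinv => <- <-; split; first lia.
have ls := string_bleft j ws'; have rs := string_bright j ws'.
by case: e => [[e1 e2]|[e1 e2]]; [right|left]; split;
  first [exact: (streq_rinvr ls)|exact: (streq_rinvr rs)].
Qed.

Lemma valid_label_rinv w D : valid_label w D -> valid_label (rinv w) D.
Proof.
move=> [ws [sz [sp nd]]]; split; first exact: is_string_rinv.
split; first by rewrite size_rinv.
split=> [u /sp|i j lti ltj neq]; first exact: split_rinvl.
rewrite !(set_nth_default w) //.
have [h1 h2] := nd i j lti ltj neq; split=> // /(same_break_rinv ws); exact: h2.
Qed.

Lemma Sset_rinv w D u : is_string w -> Sset s t R (rinv w) D u `<=` Sset s t R w D u.
Proof.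
by move=> ws v [h1 [h2 h3]]; split=> //; split=> // h; apply: h2; apply: split_rinvl.
Qed.

Lemma Jgen_rinv w D : is_string w -> Jgen (rinv w) D = Jgen w D.
Proof.
move=> ws; have ws' := is_string_rinv ws.
suff H w' : is_string w' -> Jgen (rinv w') D `<=` Jgen w' D.
  by apply/seteqP; split; [exact: H|rewrite -{1}(rinvK ws); exact: H].
move=> {ws ws'} {w} ws z [e|[h|[u [uD Su]]]].
- left; rewrite -(rinvK ws); exact: (streq_rinvr (is_string_rinv ws)).
- by right; left.
- by right; right; exists u; split=> //; apply: Sset_rinv.
Qed.

Lemma concat2_streq u u' v v' z : is_string u' -> is_string v' ->
  streq u u' -> streq v v' -> concat2 u v z -> concat2 u' v' z.
Proof.
move=> us vs eu ev [x [y [l [ex [ey h]]]]]; exists x, y, l.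
split; first exact: (streq_trans us ex eu).
by split; first exact: (streq_trans vs ey ev).
Qed.

Lemma concat2_break_sym z j : is_string z -> j < size z.2 ->
  concat2 (bright z j) (bleft z j) (rinv z).
Proof.
move=> zs lt; have lt' : size z.2 - j.+1 < size (rinv z).2 by rewrite size_rinv; lia.
have := concat2_break (is_string_rinv zs) lt'.
rewrite -(rinv_bleft zs) // -(rinv_bright zs) //.
apply: concat2_streq; try by right.
  exact: string_bright.
exact: string_bleft.
Qed.

Lemma Jgen_strset w D : valid_label w D -> strset (Jgen w D).
Proof.
move=> vl; have ws := vl.1.
have str z : Jgen w D z -> is_string z.
  move=> [e|[[x [xD e]]|[u [uD [sp _]]]]]; first exact: streq_string e.
    exact: streq_string (label_string vl xD) e.
  exact: split_string (label_string vl uD) sp.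
split=> // z Jz; have zs := str _ Jz.
have er : streq (rinv z) z by right.
case: Jz => [e|[[x [xD e]]|[u [uD [sp [nsp nc]]]]]].
- by left; exact: (streq_trans vl.1 er e).
- right; left; exists x; split=> //.
  exact: (streq_trans (label_string vl xD) er e).
- right; right; exists u; split=> //; split; last split.
  + exact: split_streq (label_string vl uD) er sp.
  + move=> h; apply: nsp; apply: split_streq h => //.
    by right; rewrite (rinvK zs).
  + move=> x y xD c; apply: (nc x y xD).
    exact: (concat2_streq zs (label_string vl xD) er (streq_refl x) c).
Qed.

Lemma JE w D : valid_label w D -> J w D = concats (Jgen w D).
Proof. by move=> vl; apply: closureE; apply: Jgen_strset. Qed.

Lemma J_rinv w D : valid_label w D -> J (rinv w) D = J w D.
Proof.
move=> vl; rewrite !JE //; last exact: valid_label_rinv.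
by rewrite Jgen_rinv //; exact: vl.1.
Qed.

Lemma Jgen_size w D z : valid_label w D -> Jgen w D z -> size z.2 <= size w.2.
Proof.
move=> [_ [_ [sp _]]] [/streq_size -> //|[[x [/sp/split_size lt /streq_size ->]]|]].
  exact: ltnW.
move=> [u [/sp/split_size lt [/split_size lt' _]]]; exact/ltnW/(ltn_trans lt').
Qed.

(** * Splits of the top string inside J *)

Lemma Jgen_split w D z : is_split w z -> Jgen w D z ->
  exists2 x, x \in D & streq z x.
Proof.
move=> sp [e|[[x [xD e]]|[u [_ [_ [nsp _]]]]]].
- by move: (split_size sp); rewrite (streq_size e) ltnn.
- by exists x.
- by case: nsp.
Qed.

(* A factor of [w] away from both ends is no split of [w], as [w] is
   self-avoiding; in J it could only come from some S(u), whose elements cannot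
   be concatenated with the splits in D. *)
Lemma Jgen_middle w D i q : valid_label w D -> i < size w.2 ->
  q < size (bright w i).2 -> Jgen w D (bleft w i) ->
  Jgen w D (bleft (bright w i) q) -> False.
Proof.
move=> vl lti ltq Jl Jm; have ws := vl.1; have rs := string_bright i ws.
set m := bleft (bright w i) q in Jm.
have nsp : ~ is_split w m.
  move=> [p [ltp [e|e]]].
    apply: (@break_disjoint w i w.1 ws lti); first exact: mem_head.
    rewrite (verts_break rs ltq) mem_cat -/m (verts_streq (string_bleft p ws) e).
    by rewrite mem_head.
  apply: (@break_disjoint (bright w i) q (endv w) rs ltq).
    rewrite -/m (verts_streq (string_bright p ws) e) -(endv_bright ws ltp).
    exact: endv_verts.
  rewrite -(endv_bright ws lti) -(endv_bright rs ltq); exact: endv_verts.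
have [x xD ex] : exists2 x, x \in D & streq (bleft w i) x.
  by apply: Jgen_split Jl => //; exists i; split=> //; do 2 left.
have xs := label_string vl xD.
rewrite size_bright in ltq.
have ltm : i < size (bleft w (i + q.+1)).2 by rewrite size_bleft; lia.
have := concat2_break_sym (string_bleft (i + q.+1) ws) ltm.
rewrite bleft_bleft; last by lia.
rewrite bright_bleft; last by lia.
have -> : i + q.+1 - i.+1 = q by lia.
rewrite -/m => c.
have ms : is_string m by apply: string_bleft.
have {}c := concat2_streq ms xs (streq_refl m) ex c.
case: Jm => [e|[[y [yD e]]|[u [uD [_ [_ nc]]]]]].
- move: (streq_size e); rewrite /m size_bleft ?size_bright; lia.
- by apply: nsp; apply: (split_streq ws e); apply: vl.2.2.1.
- exact: nc xD c.
Qed.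

Lemma concats_head X z : concats X z -> X z \/
  exists2 j, j < size z.2 & X (bleft z j) /\ concats X (bright z j).
Proof. by case=> {z} [z|z j _ lt Xl Sr]; [left | right; exists j]. Qed.

(** With two or more pieces, the first would be a prefix of [w] and the second an inner factor, both
    generators, against [Jgen_middle]. So the prefix is itself a generator. *)
Lemma prefix_in_label w D j : valid_label w D -> j < size w.2 ->
  concats (Jgen w D) (bleft w j) -> exists2 x, x \in D & streq (bleft w j) x.
Proof.
move=> vl lt /concats_head[Jz|[i]].
  by apply: Jgen_split Jz => //; exists j; split=> //; do 2 left.
rewrite size_bleft // => ij [Jl Sr]; exfalso.
rewrite bleft_bleft in Jl; last exact: ltnW.
rewrite bright_bleft // in Sr.
have lti : i < size w.2 by exact: ltn_trans lt.
case/concats_head: Sr => [Jm|[i' lt' [Jm _]]].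
  by apply: (Jgen_middle vl lti _ Jl Jm); rewrite size_bright; lia.
rewrite size_bleft in lt'; last by rewrite size_bright; lia.
rewrite bleft_bleft in Jm; last exact: ltnW.
by apply: (Jgen_middle vl lti _ Jl Jm); rewrite size_bright; lia.
Qed.

Lemma suffix_in_label w D j : valid_label w D -> j < size w.2 ->
  concats (Jgen w D) (bright w j) -> exists2 x, x \in D & streq (bright w j) x.
Proof.
move=> vl lt Sr; have ws := vl.1; have vl' := valid_label_rinv vl.
have lt' : size w.2 - j.+1 < size (rinv w).2 by rewrite size_rinv; lia.
have [|x xD e] := prefix_in_label vl' lt'.
  rewrite Jgen_rinv // -(rinv_bright ws lt).
  by apply: (concats_strset (Jgen_strset vl)).2.
exists x => //; rewrite -(rinv_bright ws lt) in e.
rewrite -(rinvK (string_bright j ws)).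
by apply: (streq_trans (label_string vl xD) _ e); right.
Qed.

(** Both sides would lie in [D]. As distinct entries they would share a break, and as the same entry
    they would share vertices. *)
Lemma J_unbreakable w D : valid_label w D -> unbreakable (J w D) w.
Proof.
move=> vl j lt; rewrite JE // => /(prefix_in_label vl lt)[x xD ex].
move=> /(suffix_in_label vl lt)[y yD ey].
have [ws [_ [_ nd]]] := vl.
have ls := string_bleft j ws; have rs := string_bright j ws.
have [E|ne] := eqVneq (index x D) (index y D).
  have Exy : x = y by rewrite -(nth_index w xD) E nth_index.
  subst y; apply: (@break_disjoint w j (bright w j).1 ws lt); last exact: mem_head.
  have xs := label_string vl xD.
  by rewrite (verts_streq xs ex) -(verts_streq xs ey) mem_head.
have [||_] := nd _ _ _ _ ne; rewrite ?index_mem //; apply.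
rewrite !nth_index //; exists j; split=> //; left.
by split; [exact: (streq_sym (label_string vl xD) ex)
          | exact: (streq_sym (label_string vl yD) ey)].
Qed.

(** Pigeonhole: sending each entry of [D] to a break it comes from is injective between sets of the
    same size, hence onto. *)
Lemma label_break w D j : valid_label w D -> j < size w.2 ->
  exists2 x, x \in D & streq x (bleft w j) \/ streq x (bright w j).
Proof.
move=> [ws [sz [sp nd]]] lt.
have /choice[f fP] : forall i : 'I_(size D), exists p : 'I_(size w.2),
    streq (nth w D i) (bleft w p) \/ streq (nth w D i) (bright w p).
  by move=> i; have [p [ltp h]] := sp _ (mem_nth w (ltn_ord i)); exists (Ordinal ltp).
have f_inj : injective f.
  move=> i i' E; apply/eqP; apply: contrapT => /negP ne.
  have [] := nd i i' (ltn_ord i) (ltn_ord i') ne.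
  have ls := string_bleft (f i) ws; have rs := string_bright (f i) ws.
  have := fP i'; have := fP i; rewrite -E => -[e|e] [e'|e'] ns nb.
  - by apply: ns; apply: (streq_trans (streq_string ls e') e (streq_sym ls e')).
  - by apply: nb; exists (f i); split=> //; left.
  - by apply: nb; exists (f i); split=> //; right.
  - by apply: ns; apply: (streq_trans (streq_string rs e') e (streq_sym rs e')).
have leD : #|'I_(size w.2)| <= #|'I_(size D)| by rewrite !card_ord sz.
have /codomP[i Ei] := inj_card_onto f_inj leD (Ordinal lt).
exists (nth w D i); first exact: mem_nth.
by have := fP i; rewrite -Ei.
Qed.

(** No generator is longer than [w], so the condition on generators in [concats_extension] is
    vacuous. *)
Lemma J_extension w D : valid_label w D -> biclosed (J w D) ->
  forall w', streq w' w -> forall z j, J w D z -> j < size z.2 ->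
  bleft z j = w' -> J w D (bright z j).
Proof.
move=> vl bJ w' e z j; have sz := streq_size e; rewrite JE //.
have bJ' : biclosed (concats (Jgen w D)) by rewrite -JE.
have nb : unbreakable (concats (Jgen w D)) w by rewrite -JE //; apply: J_unbreakable.
apply: (concats_extension (Jgen_strset vl) bJ').
  by case: e => -> //; apply: unbreakable_rinv => //; [exact: bJ'.1 | exact: vl.1].
move=> {}z {}j Jz lt E; have := Jgen_size vl Jz.
by rewrite -sz -E size_bleft // leqNgt lt.
Qed.

Lemma J_remove_biclosed w D : valid_label w D -> biclosed (J w D) ->
  biclosed (remove (J w D) w).
Proof.
move=> vl bJ; apply: remove_biclosed => //; first exact: vl.1.
  exact: J_unbreakable.
exact: J_extension.
Qed.

Lemma J_top w D : valid_label w D -> J w D w.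
Proof. by move=> vl; rewrite JE //; apply: concats_base; left; left. Qed.

Lemma label_J w D x : valid_label w D -> x \in D -> J w D x.
Proof.
move=> vl xD; rewrite JE //; apply: concats_base; right; left.
by exists x; split=> //; left.
Qed.

(** * Minimality of J *)

Lemma split_streql u u' v : is_string u' -> streq u u' -> is_split u v -> is_split u' v.
Proof.
move=> us' [-> //|E] h; have us : is_string u by rewrite E is_string_rinv.
by rewrite -(rinvK us') -E; apply: (split_rinvl us).
Qed.

(** A prefix of [u] is a split of [w], so [v] is a suffix of [u], following the prefix [bleft w i].
    That prefix is not in [D], as it can be concatenated with [v]; hence [bright w i] is. By
    co-closedness at [u], either [v] or [bleft w i] lies in [Z], and the latter would give break i
    both sides. *)
Lemma Sset_prefix w D Z u v j : valid_label w D -> biclosed Z ->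
  unbreakable (Z `|` J w D) w -> u \in D -> Z u -> Sset s t R w D u v ->
  j < size w.2 -> streq u (bleft w j) -> Z v.
Proof.
move=> vl /biclosedP[sZ _ coZ] nb uD Zu [spv [nsp nc]] lt eu.
have ws := vl.1; have ls := string_bleft j ws; have us := label_string vl uD.
have [i [lti ev]] := split_streql ls eu spv.
rewrite size_bleft // in lti; have ltw : i < size w.2 := ltn_trans lti lt.
have lti' : i < size (bleft w j).2 by rewrite size_bleft.
have vs : is_string v by apply: split_string us spv.
case: ev => ev.
  by case: nsp; exists i; split=> //; left; rewrite bleft_bleft in ev; rewrite // ltnW.
have ms := string_bright i ls.
have Zl : Z (bleft w j) by apply: (strset_streq sZ ls _ Zu); apply: (streq_sym ls).
have [x xD [ex|ex]] := label_break vl ltw.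
  have := concat2_break_sym ls lti'; rewrite bleft_bleft; last exact: ltnW.
  move=> c; case: (nc x (rinv (bleft w j)) xD); apply: concat2_streq c => //.
  - exact: (label_string vl xD).
  - exact: (streq_sym ms).
  - by apply: (streq_sym (string_bleft i ws)).
have Jr : J w D (bright w i).
  have sJ := concats_strset (Jgen_strset vl); rewrite -JE // in sJ.
  apply: (strset_streq sJ (string_bright i ws) _ (label_J vl xD)).
  exact: (streq_sym (string_bright i ws)).
have [|Zm] := coZ _ i lti' Zl; last exact: (strset_streq sZ vs ev).
by rewrite bleft_bleft 1?ltnW // => Zi; case: (nb i ltw); [left|right].
Qed.

(** Since [Z] contains [w], it contains a side of every break, and it must be the side chosen by
    [D]. The sets S(u) follow from [Sset_prefix], applied to the inverse of [w] when u is a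
    suffix. *)
Lemma J_least w D Z : valid_label w D -> biclosed Z -> Z w ->
  unbreakable (Z `|` J w D) w -> J w D `<=` Z.
Proof.
move=> vl bZ Zw nb; have ws := vl.1; have /biclosedP[sZ cZ coZ] := bZ.
have sJ := concats_strset (Jgen_strset vl); rewrite -JE // in sJ.
have DZ x : x \in D -> Z x.
  move=> xD; have xs := label_string vl xD.
  have [j [lt ex]] := vl.2.2.1 x xD; have Jx := label_J vl xD.
  have ls := string_bleft j ws; have rs := string_bright j ws.
  case: ex => ex; have [Zl|Zr] := coZ _ _ lt Zw.
  - exact: (strset_streq sZ xs ex).
  - case: (nb j lt); [right|by left].
    by apply: (strset_streq sJ ls _ Jx); apply: (streq_sym ls).
  - case: (nb j lt); [by left|right].
    by apply: (strset_streq sJ rs _ Jx); apply: (streq_sym rs).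
  - exact: (strset_streq sZ xs ex).
rewrite JE //; apply: concats_min => // z [ez|[[x [xD ex]]|[u [uD Su]]]].
- by apply: (strset_streq sZ _ ez Zw); apply: streq_string ez.
- have xs := label_string vl xD.
  by apply: (strset_streq sZ _ ex (DZ x xD)); apply: streq_string ex.
- have [j [lt [eu|eu]]] := vl.2.2.1 u uD.
    exact: Sset_prefix vl bZ nb uD (DZ u uD) Su lt eu.
  have lt' : size w.2 - j.+1 < size (rinv w).2 by rewrite size_rinv; lia.
  apply: (Sset_prefix (valid_label_rinv vl) bZ _ uD (DZ u uD) _ lt').
  + rewrite J_rinv //; apply: (unbreakable_rinv _ ws nb); split=> y.
      by move=> [/sZ.1|/sJ.1].
    by move=> [/sZ.2|/sJ.2]; [left|right].
  + by apply: (Sset_rinv (is_string_rinv ws)); rewrite (rinvK ws).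
  + by rewrite -(rinv_bright ws lt); apply: (streq_rinvr (string_bright j ws)).
Qed.

(** * Concatenations of several strings *)

Lemma glue_prefix u rest : exists tl, glue u rest = (u.1, u.2 ++ tl).
Proof.
elim: rest u => [|[l v] r IH] [x us]; first by exists [::]; rewrite cats0.
have [tl E] := IH (x, us ++ l :: v.2); exists ((l :: v.2) ++ tl).
by rewrite [LHS]E -catA.
Qed.

Lemma glue_size u rest : size u.2 <= size (glue u rest).2.
Proof. by have [tl ->] := glue_prefix u rest; rewrite size_cat leq_addr. Qed.

Lemma glue_size_in u (rest : seq (letter * rstr)) p : List.In p rest ->
  size p.2.2 < size (glue u rest).2.
Proof.
elim: rest u => [|[l v] r IH] u //= [<-|/IH //].
by apply: leq_trans (glue_size _ _); rewrite size_cat /=; lia.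
Qed.

Lemma glue_closed X u (rest : seq (letter * rstr)) :
  biclosed X -> junctions_ok s t u rest -> is_string (glue u rest) ->
  X u -> (forall p, List.In p rest -> X p.2) -> X (glue u rest).
Proof.
move=> bX; have /biclosedP[sX cX _] := bX.
elim: rest u => [|[l v] r IH] u //= /and3P[h1 h2 jo] gs Xu Xr.
apply: IH => //; last by move=> p hp; apply: Xr; right.
have [lt El Er] := @break_glue u v l (introT and3P (And3 h1 h2 isT)).
have ys : is_string (u.1, u.2 ++ l :: v.2).
  have [tl E] := glue_prefix (u.1, u.2 ++ l :: v.2) r.
  have := string_bleft (size (u.2 ++ l :: v.2)) gs.
  by rewrite E /bleft /= take_size_cat.
apply: (cX _ (size u.2)) => //.
  by rewrite [bleft _ _]El.
by rewrite [bright _ _]Er; apply: (Xr (l, v)); left.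
Qed.

Local Notation concat_of := (concat_of s t R).

(** The pieces of a proper concatenation are shorter than [w], so only the shorter elements of [X]
    have to be in [Y]; this is what allows [Y] to omit [w] in the applications. *)
Lemma concat_of_in X Y w : is_string w -> biclosed Y -> concat_of X w ->
  (forall u, X u -> size u.2 < size w.2 -> Y u) -> Y w.
Proof.
move=> ws bY [u [rest [ne [[u' [Xu' eu]] [hr [jo [gs ew]]]]]]] XY.
have sY := bY.1; apply: (strset_streq sY ws ew).
have sz : size (glue u rest).2 = size w.2 by rewrite (streq_size ew).
have in_Y v v' : streq v v' -> X v' -> size v.2 < size w.2 -> Y v.
  move=> e Xv lt; have Yv' : Y v' by apply: XY => //; rewrite -(streq_size e).
  by apply: (strset_streq sY _ e Yv'); apply: streq_string e; apply: sY.1.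
apply: glue_closed => //.
  apply: in_Y eu Xu' _; rewrite -sz; case: rest ne {hr jo gs ew sz} => // -[l v] r _.
  by apply: leq_trans (glue_size (u.1, u.2 ++ l :: v.2) r); rewrite size_cat /=; lia.
move=> p hp; have [v' [Xv' ev]] := hr p hp; apply: in_Y ev Xv' _.
by rewrite -sz; apply: glue_size_in.
Qed.

Lemma concat_of_streq X z w : is_string z -> streq z w -> is_string w ->
  concat_of X z -> concat_of X w.
Proof.
move=> zs e ws [u [rest [h1 [h2 [h3 [h4 [h5 h6]]]]]]]; exists u, rest.
do 5 (split; first by []); apply: (streq_trans h5 _ h6); exact: (streq_sym ws).
Qed.

Lemma concat_of_break X z j : is_string z -> j < size z.2 ->
  X (bleft z j) -> X (bright z j) -> concat_of X z.
Proof.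
move=> zs lt Xl Xr; have [l [jo E]] := glue_break zs lt.
exists (bleft z j), [:: (l, bright z j)]; rewrite E; split=> //.
split; first by exists (bleft z j); split=> //; left.
split; last by split=> //; split=> //; left.
by move=> p [<-|//]; exists (bright z j); split=> //; left.
Qed.

Lemma concat_of_break2 X z i j : is_string z -> i < j -> j < size z.2 ->
  X (bleft z i) -> X (bright (bleft z j) i) -> X (bright z j) -> concat_of X z.
Proof.
move=> zs lt ltj Xl Xm Xr; have [l [jo E]] := glue_break zs ltj.
have lti : i < size (bleft z j).2 by rewrite size_bleft.
have [l' [jo' E']] := glue_break (string_bleft j zs) lti.
rewrite bleft_bleft 1?ltnW // in jo' E'; set m := bright (bleft z j) i in Xm jo' E'.
exists (bleft z i), [:: (l', m); (l, bright z j)].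
have Eg : glue (bleft z i) [:: (l', m); (l, bright z j)] = z.
  by rewrite -[LHS]/(glue (glue _ [:: (l', m)]) [:: (l, bright z j)]) E' E.
rewrite Eg; split=> //; split; first by exists (bleft z i); split=> //; left.
split.
  by move=> p [<-|[<-|//]]; [exists m | exists (bright z j)]; split=> //; left.
split; last by split=> //; left.
have /and3P[h1 h2 _] := jo'; apply/and3P; split=> //.
change (junctions_ok s t (glue (bleft z i) [:: (l', m)]) [:: (l, bright z j)]).
by rewrite E'.
Qed.

Local Notation JI := (JI s t R).
Local Notation is_join := (is_join s t R).
Local Notation irredundant := (irredundant s t R).

(** * Finiteness and join decompositions *)

Lemma words_enum n : exists l : seq (seq letter), forall p, size p <= n -> p \in l.
Proof.
elim: n => [|n [l lP]].
  by exists [:: [::]] => p; rewrite leqn0 size_eq0 mem_seq1.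
exists ([::] :: [seq a :: p | a <- enum {: letter}, p <- l]) => -[|a p] //= lt.
rewrite inE /=; apply/allpairsP; exists (a, p); split=> //=; last exact: lP.
by rewrite mem_enum.
Qed.

(** A string repeats no vertex, so its length is bounded by the number of vertices. *)
Lemma strings_enum : exists l : seq rstr, forall z, is_string z -> z \in l.
Proof.
have [l lP] := words_enum #|Q0|.
exists [seq (x, p) | x <- enum Q0, p <- l] => -[x p] zs.
apply/allpairsP; exists (x, p); split=> //=; first by rewrite mem_enum.
apply: lP; have /card_uniqP E := avoid zs.
by have := max_card (mem (verts (x, p))); rewrite E /verts /= size_map; apply: ltnW.
Qed.

Lemma subsets_enum (T : eqType) (l : seq T) : exists L : seq (set T),
  forall X : set T, (forall z : T, X z -> z \in l) -> List.In X L.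
Proof.
elim: l => [|a l [L LP]].
  by exists [:: set0] => Y Y0; left; apply/seteqP; split=> z // /Y0.
exists (L ++ List.map (setU [set a]) L) => Y YP; apply/List.in_app_iff.
have [Ya|nYa] := pselect (Y a); [right|left].
  apply/List.in_map_iff; exists (Y `\` [set a]); split.
    by rewrite setDUK // => z ->.
  apply: LP => z [Yz /eqP nz]; have := YP z Yz.
  by rewrite inE (negbTE nz).
apply: LP => z Yz; have := YP z Yz; rewrite inE => /orP[/eqP E|//].
by case: nYa; rewrite -E.
Qed.

Lemma biclosed_finite F : (forall Y, F Y -> biclosed Y) -> finite_family F.
Proof.
move=> bF; have [l lP] := strings_enum; have [L LP] := subsets_enum l.
by exists L => Y /bF[[sY _] _]; apply: LP => z /sY; apply: lP.
Qed.

(** Induction on the number of strings in [X]: if [X] is not join-irreducible, it is a join of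
    biclosed proper subsets. *)
Lemma JI_decomposition X : biclosed X -> is_join [set Y | JI Y /\ Y `<=` X] X.
Proof.
have [l lP] := strings_enum; pose m X := count (fun z => `[<X z>]) l.
have [n] := ubnP (m X); elim: n X => // n IH X ltn bX.
split=> //; split=> [Y []//|Z bZ ZP].
have [JX|nJX] := pselect (JI X); first by apply: ZP; split.
have [F [fF [bF [jF nF]]]] : exists F, finite_family F /\
    (forall y, F y -> biclosed y) /\ is_join F X /\ ~ F X.
  apply: contrapT => H; apply: nJX; split=> // F fF bF jF.
  by apply: contrapT => nF; apply: H; exists F.
apply: jF.2.2 => // Y FY; have YX := jF.2.1 _ FY.
have [z [Xz nYz]] : exists z, X z /\ ~ Y z.
  apply: contrapT => H; apply: nF; suff <- : Y = X by [].
  apply/seteqP; split=> // z Xz; apply: contrapT => nz; apply: H; by exists z.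
have ltm : m Y < m X.
  have zl := lP z (bX.1.1 _ Xz).
  rewrite /m !(permP (perm_to_rem zl)) /=.
  rewrite (asboolT Xz) (asboolF nYz) ltnS.
  by apply: sub_count => y /asboolP Yy; apply/asboolP; apply: YX.
apply: (IH Y _ (bF _ FY)).2.2 => //; first by lia.
by move=> y [Jy yY]; apply: ZP; split=> // z' /yY /YX.
Qed.

Lemma irredundant_subfamily F x : finite_family F -> is_join F x ->
  exists2 G, G `<=` F & irredundant G x.
Proof.
move=> [l lP]; have [n] := ubnP (length l); elim: n l F lP => // n IH l F lP lt jF.
have [H|nH] := pselect (forall G, G `<=` F -> G <> F -> ~ is_join G x).
  by exists F => //; split.
have [G [GF [neG jG]]] : exists G, G `<=` F /\ G <> F /\ is_join G x.
  apply: contrapT => H; apply: nH => G GF neG jG; apply: H; by exists G.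
have [a [Fa nGa]] : exists a, F a /\ ~ G a.
  apply: contrapT => H; apply: neG; apply/seteqP; split=> // a Fa.
  by apply: contrapT => nG; apply: H; exists a.
have [l1 [l2 El]] := List.in_split _ _ (lP _ Fa).
have [|||G' G'G irr] := IH (app l1 l2) G; last by exists G' => // y /G'G /GF.
- move=> b Gb; have := lP b (GF _ Gb); rewrite El => /List.in_app_iff[h|[E|h]].
  + by apply/List.in_app_iff; left.
  + by case: nGa; rewrite E.
  + by apply/List.in_app_iff; right.
- by move: lt; rewrite El !List.length_app /=; lia.
- exact: jG.
Qed.

(** * Faces of the canonical join complex *)

Section Family.
Variables (n : nat) (w : 'I_n -> rstr) (D : 'I_n -> seq rstr).
Hypothesis lab : forall i, valid_label (w i) (D i).
Local Notation K i := (J (w i) (D i)).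
Hypothesis JIK : forall i, JI (K i).

Let F : set (set rstr) := range (fun i => K i).
Let X : set rstr := concats (Union F).

Let bK i : biclosed (K i). Proof. exact: (JIK i).1. Qed.

Let bF Y : F Y -> biclosed Y. Proof. by move=> [i _ <-]. Qed.

Let jX : is_join F X. Proof. exact: concats_Union_is_join. Qed.

Let KX i : K i `<=` X. Proof. by apply: jX.2.1; exists i. Qed.

(** * Sufficiency of the pairwise conditions *)

Section Sufficient.
Hypothesis no_concat : forall i j, i != j -> ~ concat_of (K i `|` K j) (w i).
Hypothesis incomparable : forall i j, i != j -> ~ K i `<=` K j.

(** For equal indices, all pieces lie in the biclosed set [K i] minus [w i], hence so would their
    concatenation. *)
Lemma no_concat_all i j : ~ concat_of (K i `|` K j) (w i).
Proof.
have [<-|/no_concat //] := eqVneq i j.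
rewrite setUid => c; have ws := (lab i).1.
have [|_ []] := concat_of_in ws (J_remove_biclosed (lab i) (bK i)) c; last by left.
by move=> u Ku lt; split=> // e; rewrite (streq_size e) ltnn in lt.
Qed.

(* Each break of [v] has a side in [K i].  At the first break inside the second side
   whose right side is in [K i], [v] splits into three pieces, the outer ones in
   [K i] and the middle one in some [K p]; without such a break it splits into two. *)
Lemma no_suffix i v j : streq v (w i) -> j < size v.2 ->
  K i (bleft v j) -> X (bright v j) -> False.
Proof.
move=> e + + Xr; have ws := (lab i).1; have vs := streq_string ws e.
have nc p : ~ concat_of (K i `|` K p) v.
  by move=> c; apply: (@no_concat_all i p); apply: concat_of_streq c.
move: {-2}(bright v j) Xr (erefl (bright v j)) => y Xy.
elim: Xy j => {y} [y [Y [p _ <-] Kp]|y q ys ltq [Y [p _ <-] Kp] _ IH] j Ey lt Kl.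
  by subst y; apply: (nc p); apply: (concat_of_break vs lt); [left|right].
subst y; have ltj : j + q.+1 < size v.2 by move: ltq; rewrite size_bright; lia.
have /biclosedP[sK _ coK] := bK i.
have Kv : K i v by apply: (strset_streq sK vs e); apply: J_top.
have [Kl'|Kr'] := coK _ _ ltj Kv.
  by apply: (IH (j + q.+1)) => //; rewrite bright_bright.
apply: (nc p); apply: (@concat_of_break2 _ v j (j + q.+1)) => //.
- by lia.
- by left.
- right; rewrite bright_bleft; last by lia.
  by have -> : j + q.+1 - j.+1 = q by lia.
- by left.
Qed.

Lemma X_unbreakable i : unbreakable X (w i).
Proof.
move=> j lt Xl Xr; have ws := (lab i).1; have /biclosedP[sK _ coK] := bK i.
have [Kl|Kr] := coK _ _ lt (J_top (lab i)).
  exact: (no_suffix (streq_refl _) lt Kl Xr).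
(* The remaining case is the previous one for the inverse of [w i]. *)
have lt' : size (w i).2 - j.+1 < size (rinv (w i)).2 by rewrite size_rinv; lia.
apply: (@no_suffix i (rinv (w i)) _ _ lt'); first by right.
  by rewrite -(rinv_bright ws lt); apply: sK.2.
by rewrite -(rinv_bleft ws lt); apply: jX.1.1.2.
Qed.

Lemma K_least i Z : biclosed Z -> Z `<=` X -> Z (w i) -> K i `<=` Z.
Proof.
move=> bZ ZX Zw; apply: (J_least (lab i) bZ Zw) => j lt Hl Hr.
by apply: (X_unbreakable lt); [case: Hl => [/ZX|/KX] | case: Hr => [/ZX|/KX]].
Qed.

Lemma other_top i j : i != j -> ~ K j (w i).
Proof.
by move=> ne Kw; apply: (incomparable ne); apply: K_least Kw; [apply: bK|apply: KX].
Qed.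

Lemma X_remove_biclosed i : biclosed (remove X (w i)).
Proof.
have ws := (lab i).1; have sX := jX.1.1.
apply: (remove_biclosed jX.1 ws (@X_unbreakable i)) => w' e.
apply: concats_extension.
- exact: Union_strset.
- exact: jX.1.
- case: e => ->; first exact: X_unbreakable.
  by apply: (unbreakable_rinv sX ws); apply: X_unbreakable.
(* For p other than i, the prefix is not in [K p], so co-closedness of [K p] gives the other
   side. *)
- move=> z j [Y [p _ <-] Kz] lt E; apply: (@KX p).
  have [Ep|ne] := eqVneq i p.
    by subst p; apply: (J_extension (lab i) (bK i) e Kz lt E).
  have /biclosedP[sK _ coK] := bK p.
  have [Kl|//] := coK _ _ lt Kz; case: (other_top ne).
  apply: (strset_streq sK ws _ Kl); rewrite E.
  by apply: (streq_sym ws).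
Qed.

Lemma top_not_joined i (G : set (set rstr)) :
  (forall y, G y -> y `<=` remove X (w i)) -> ~ is_join G X.
Proof.
move=> GP jG; have := jG.2.2 _ (X_remove_biclosed i) GP (w i).
by case=> [|_]; [apply: (@KX i); apply: J_top | apply; left].
Qed.

Lemma family_face : cj_face s t R F.
Proof.
exists X; split; first exact: jX.1.
split; first exact: biclosed_finite.
split; first by move=> y [i _ <-].
split.
  split=> // Y YF neY jY.
  have [i nYi] : exists i, ~ Y (K i).
    apply: contrapT => H; apply: neY; apply/seteqP; split=> // y [i _ <-].
    by apply: contrapT => nY; apply: H; exists i.
  apply: (@top_not_joined i Y) => // y Yy; have [p _ Ep] := YF _ Yy; subst y.
  have ne : i != p by apply/eqP => E; subst p.
  move=> z Kz; split; first exact: KX Kz.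
  move=> e; apply: (other_top ne); apply: (strset_streq (bK p).1 (lab i).1 _ Kz).
  exact: (streq_sym (lab i).1).
(* If no joinand contained [w i], all would lie in the biclosed set [X] minus [w i]. A joinand
   containing it contains [K i] by minimality. *)
move=> Y fY JY [jY _] a [i _ <-].
have [y [Yy yw]] : exists y, Y y /\ y (w i).
  apply: contrapT => H; apply: (@top_not_joined i Y) => // y Yy z yz.
  split; first exact: jY.2.1 Yy _ yz.
  move=> e; apply: H; exists y; split=> //.
  apply: (strset_streq (JY _ Yy).1.1 (lab i).1 _ yz).
  exact: (streq_sym (lab i).1).
exists y; split=> //; apply: K_least => //; first exact: (JY _ Yy).1.
exact: jY.2.1.
Qed.
End Sufficient.

(** * Necessity of the pairwise conditions *)

Section Necessary.
Hypothesis K_inj : forall i j, i != j -> K i <> K j.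
Hypothesis face : cj_face s t R F.

Let canonical : canonical_join_rep s t R X F.
Proof.
have [x [bx cx]] := face; suff <- : x = X by [].
exact: is_join_unique cx.2.2.1.1 jX.
Qed.

Lemma face_incomparable i j : i != j -> ~ K i `<=` K j.
Proof.
move=> ne Kij; have irr := canonical.2.2.1.2.
apply: (irr [set Y | F Y /\ Y <> K i]).
- by move=> Y [].
- move=> E; have : F (K i) by exists i.
  by rewrite -E => -[].
split; first exact: jX.1.
split=> [Y [FY _]|Z bZ ZP]; first exact: jX.2.1.
apply: jX.2.2 => // Y FY; have [->|ne'] := pselect (Y = K i); last exact: ZP.
apply: (subset_trans Kij); apply: ZP; split; first by exists j.
by apply/nesym/K_inj.
Qed.

(* Otherwise the other [K p], together with the join-irreducibles below [K i]
   minus [w i], would join to [X], and none of them is above [K i]. *)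
Lemma face_top_isolated i : exists Z, [/\ biclosed Z,
  forall p, p != i -> K p `<=` Z, remove (K i) (w i) `<=` Z & ~ Z (w i)].
Proof.
apply: contrapT => H; have ws := (lab i).1.
(* Canonicity compares only with families of join-irreducibles, so [K i] minus [w i] is replaced by
   those below it. *)
have jrm := JI_decomposition (J_remove_biclosed (lab i) (bK i)).
pose G := [set Y | JI Y /\
  ((exists2 p, p != i & Y = K p) \/ Y `<=` remove (K i) (w i))].
have jG : is_join G X.
  split; first exact: jX.1.
  split=> [Y [_ [[p _ ->]|h]]|Z bZ ZP]; first exact: KX.
    by move=> z /h[Kz _]; apply: KX Kz.
  have ZK p : p != i -> K p `<=` Z by move=> ne; apply: ZP; split=> //; left; exists p.
  have Zrm : remove (K i) (w i) `<=` Z.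
    by apply: jrm.2.2 => // Y [JY Yr]; apply: ZP; split=> //; right.
  have Zw : Z (w i) by apply: contrapT => nZ; apply: H; exists Z.
  apply: jX.2.2 => // Y [p _ <-]; have [->|ne] := eqVneq p i; last exact: ZK.
  move=> z Kz; have [e|ne] := pselect (streq z (w i)); last exact: Zrm.
  by apply: (strset_streq bZ.1 (streq_string ws e) e).
have fG : finite_family G by apply: biclosed_finite => Y [[]].
have [G' G'G irr] := irredundant_subfamily fG jG.
have JG' y : G' y -> JI y by move=> /G'G[].
(* The joinand above [K i] is either another [K p], against incomparability, or inside [K i] minus
   [w i], which misses [w i]. *)
have [||b [/G'G[_ [[p ne ->]|h]] Kb]] := canonical.2.2.2 G' _ JG' irr (K i).
- by apply: biclosed_finite => Y /JG'[].
- by exists i.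
- by apply: (@face_incomparable i p) => //; rewrite eq_sym.
- by have [_ []] := h _ (Kb _ (J_top (lab i))); left.
Qed.

Lemma face_tops_distinct i j : i != j -> ~ streq (w i) (w j).
Proof.
move=> ne e; have [Z [bZ ZK _]] := face_top_isolated i; apply.
apply: (strset_streq bZ.1 (lab i).1 e); apply: (ZK j); first by rewrite eq_sym.
exact: J_top.
Qed.

(** All pieces are shorter than [w i] and hence lie in the biclosed set of [face_top_isolated],
    which would then contain [w i]. *)
Lemma face_no_concat i j : i != j -> ~ concat_of (K i `|` K j) (w i).
Proof.
move=> ne c; have [Z [bZ ZK Zrm]] := face_top_isolated i; apply.
apply: (concat_of_in (lab i).1 bZ c) => u [Ku|Ku] lt.
  by apply: Zrm; split=> // e; rewrite (streq_size e) ltnn in lt.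
by apply: ZK Ku; rewrite eq_sym.
Qed.
End Necessary.

Lemma face_iff : (forall i j, i != j -> K i <> K j) ->
  cj_face s t R F <-> (forall i j : 'I_n, i != j ->
     ~ streq (w i) (w j) /\
     ~ concat_of (K i `|` K j) (w i) /\ ~ concat_of (K i `|` K j) (w j) /\
     ~ (K i `<=` K j) /\ ~ (K j `<=` K i)).
Proof.
move=> inj; split=> [face i j ne|H].
  have ne' : j != i by rewrite eq_sym.
  split; first exact: face_tops_distinct.
  split; first exact: face_no_concat.
  split; first by rewrite setUC; apply: face_no_concat.
  by split; apply: face_incomparable.
by apply: family_face => i j /H[_ [h1 [_ [h2 _]]]].
Qed.
End Family.
End Strings.

Theorem theorem8p1 (k : fieldType) (Q0 Q1 : finType) (s t : Q1 -> Q0)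
  (R : rel Q1) (hA : brick_gentle s t R k)
  (n : nat) (w : 'I_n -> rstr Q0 Q1) (D : 'I_n -> seq (rstr Q0 Q1))
  (hlab : forall i, valid_label s t R (w i) (D i))
  (hJI : forall i, JI s t R (J s t R (w i) (D i)))
  (hdist : forall i j, i != j -> J s t R (w i) (D i) <> J s t R (w j) (D j)) :
  cj_face s t R (range (fun i => J s t R (w i) (D i))) <->
  (forall i j : 'I_n, i != j ->
     ~ streq s t (w i) (w j) /\
     ~ concat_of s t R (J s t R (w i) (D i) `|` J s t R (w j) (D j)) (w i) /\
     ~ concat_of s t R (J s t R (w i) (D i) `|` J s t R (w j) (D j)) (w j) /\
     ~ (J s t R (w i) (D i) `<=` J s t R (w j) (D j)) /\
     ~ (J s t R (w j) (D j) `<=` J s t R (w i) (D i))).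
Proof.
have avoid := string_verts_uniq hA.
exact: (face_iff avoid hlab hJI hdist).
Qed.
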